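(* Let $W$ be either a convergent Turing machine universal for the class of convergent Turing machines, or a tuatara machine universal for the class of tuatara machines. Then the zeta number $\zeta_W$ is random.
   Context: Turing machines map binary strings to binary strings (partial functions on $\Sigma^*$, $\Sigma=\{0,1\}$); $\mathrm{dom}(M)$ is the set of inputs on which $M$ halts; $M$ is self-delimiting if $\mathrm{dom}(M)$ is prefix-free. $\mathrm{bin}:\mathbf{N}=\{1,2,\dots\}\to\Sigma^*$ is the bijection sending $n$ to its binary expansion with the leading 1 removed. $\zeta_M=\sum_{n\ge1,\ \mathrm{bin}(n)\in\mathrm{dom}(M)}\frac1n$; $M$ is convergent if $\zeta_M<\infty$ and a tuatara machine if $\zeta_M\le1$. A Turing machine $W$ is universal for a class $\Re$ if for every $C\in\Re$ there is $c\ge0$ such that for every $x\in\mathrm{dom}(C)$ there is $p_x\in\mathrm{dom}(W)$ with $|p_x|\le|x|+c$ and $W(p_x)=C(x)$. For $\alpha\in(0,1)$, $\alpha[m]$ is the first $m$ bits of its unending binary expansion. For a self-delimiting $C$, $H_C(x)=\min\{|w|:C(w)=x\}$. Fix a self-delimiting Turing machine $U_0$ universal for the class of self-delimiting machines; $\alpha$ is random if there is $c\ge0$ with $H_{U_0}(\alpha[m])\ge m-c$ for all $m\ge1$. *)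

(* Defs.v *)
From HB Require Import structures.
From mathcomp Require Import all_boot all_order all_algebra.
From mathcomp Require Import all_classical all_reals all_analysis.

Set Implicit Arguments.
Unset Strict Implicit.
Unset Printing Implicit Defensive.

Import Order.TTheory GRing.Theory Num.Theory.
Import numFieldNormedType.Exports.

Local Open Scope classical_set_scope.
Local Open Scope ring_scope.

Inductive direction := Left | Stay | Right.

(* Deterministic machines with one two-way infinite tape.  The tape alphabet  *)
(* consists of the blank [None], the bits [Some (inl b)] and a finite         *)
(* supply of auxiliary symbols [Some (inr g)].                                *)
Definition symbol (G : finType) := option (bool + G).

(* The machine halts when [delta] returns [None]. *)
Record machine := Machine {
  state : finType;
  aux : finType;
  start : state;
  delta : state -> symbol aux -> option (state * symbol aux * direction)
}.

(* [tape_left] is listed outwards from the head.  All cells that are not      *)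
(* listed are blank.                                                          *)
Record tape (G : finType) := Tape {
  tape_left : seq (symbol G);
  tape_head : symbol G;
  tape_right : seq (symbol G)
}.

Definition write_move (G : finType) (s : symbol G) (d : direction)
    (t : tape G) : tape G :=
  let: Tape l _ r := t in
  match d with
  | Left => Tape (behead l) (head None l) (s :: r)
  | Stay => Tape l s r
  | Right => Tape (s :: l) (head None r) (behead r)
  end.

Definition config (M : machine) := (state M * tape (aux M))%type.

(* The head starts on the first letter of the input. *)
Definition init (M : machine) (x : seq bool) : config M :=
  let s := [seq Some (inl b) | b <- x] in
  (start M, Tape [::] (head None s) (behead s)).

Definition step (M : machine) (c : config M) : option (config M) :=
  if delta c.1 (tape_head c.2) is Some (q, s, d)
  then Some (q, write_move s d c.2) else None.

Fixpoint leading_bits (G : finType) (s : seq (symbol G)) : seq bool :=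
  if s is Some (inl b) :: s' then b :: leading_bits s' else [::].

(* The longest block of bits extending to the right from the head.            *)
Definition output (M : machine) (c : config M) : seq bool :=
  leading_bits (tape_head c.2 :: tape_right c.2).

(* [evals M x y] : M halts on the input x with output y, i.e. M(x) = y. *)
Definition evals (M : machine) (x y : seq bool) : Prop :=
  exists (n : nat) (c : config M),
    [/\ iter n (obind (@step M)) (Some (init M x)) = Some c,
        step c = None & output c = y].

Definition dom (M : machine) : set (seq bool) :=
  [set x | exists y, evals M x y].

Definition self_delimiting (M : machine) : Prop :=
  forall x y, dom M x -> dom M y -> prefix x y -> x = y.

(* The leading 1 of n > 0 is its binary digit of weight 2 ^ trunc_log 2 n;    *)
(* the remaining digits are listed from the most significant one.             *)
Definition bin (n : nat) : seq bool :=
  rev [seq odd (n %/ 2 ^ i) | i <- iota 0 (trunc_log 2 n)].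

Definition zeta (R : realType) (M : machine) : \bar R :=
  (\esum_(n in [set n : nat | (0 < n)%N /\ dom M (bin n)]) (n%:R^-1)%:E)%E.

Definition convergent (R : realType) (M : machine) : Prop :=
  (zeta R M < +oo)%E.

Definition tuatara (R : realType) (M : machine) : Prop := (zeta R M <= 1)%E.

Definition universal_for (K : machine -> Prop) (W : machine) : Prop :=
  forall C, K C -> exists c : nat, forall x y, evals C x y ->
    exists p, (size p <= size x + c)%N /\ evals W p y.

(* H_M(x), with value +oo when x is not an output of M. *)
Definition complexity (R : realType) (M : machine) (x : seq bool) : \bar R :=
  ereal_inf [set (size w)%:R%:E | w in [set w | evals M w x]].

(* The digit b i has weight 2 ^ -(i + 1).  A real number in [0, 1[ has such   *)
(* an expansion, which is then unique, iff it lies in ]0, 1[.                 *)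
Definition unending_expansion (R : realType) (b : nat -> bool) (a : R) : Prop :=
  (series (fun i => (b i)%:R / 2 ^+ i.+1 : R) @ \oo --> a) /\
  forall n, exists i, (n <= i)%N /\ b i.

(* Randomness of a real number only depends on its fractional part, which has *)
(* to lie in ]0, 1[; on ]0, 1[ the fractional part is the identity.           *)
Definition random (R : realType) (U : machine) (a : R) : Prop :=
  exists b : nat -> bool, unending_expansion b (a - (Num.floor a)%:~R) /\
  exists c : nat, forall m : nat, (0 < m)%N ->
    ((m%:R - c%:R)%:E <= complexity R U (mkseq b m))%E.

(* Main.v *)
Require Import Defs.
From HB Require Import structures.
From mathcomp Require Import all_boot all_order all_algebra.
From mathcomp Require Import all_classical all_reals all_analysis.
From mathcomp Require Import zify ring lra.

(* Let alpha be the fractional part of zeta_W and k its integer part.  From a *)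
(* program w of a self-delimiting U with U(w) = alpha[m], one enumerates the  *)
(* domain of W until the sum of the 1/n found so far exceeds k + 0.alpha[m].  *)
(* Every element bin(n) of the domain which is still missing then satisfies   *)
(* 1/n < 2^-m, so that all outputs W(p) with |p| < m are known, and the       *)
(* machine D that prints a string longer than all outputs found needs a       *)
(* program of length at least m on W.  The domain of D is contained in that   *)
(* of U, so D is self-delimiting, hence tuatara by Kraft's inequality, and    *)
(* universality of W gives m <= |w| + c.  If zeta_W were an integer, the same *)
(* argument with alpha = 0.111... and a self-delimiting machine mapping 0^j 1 *)
(* to 1^(2j) would give 2j <= j + 1 + c for all j.                            *)
(*                                                                            *)
(* D is obtained from a small programming language: functions closed under    *)
(* composition and primitive recursion are computed by counter machines with  *)
(* relative jumps, and a counter machine is run by a Turing machine that      *)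
(* stores each register in unary on a track of its tape.                      *)

(** The first m binary digits of zeta_W decide which programs shorter than m halt on W. If |bin(n)|
    < m then 1/n > 2^-m, so no such program can still be missing once a partial sum has come within
    2^-m of zeta_W. A program for these digits can thus be turned into a string that W produces from
    no program shorter than m ([diagonal_machine]), and universality of W makes the given program at
    least m - c bits long ([prefix_complexity_bound]).

    Both kinds of universality reach the diagonal machine because a self-delimiting machine has zeta
    number at most 1 ([self_delimiting_tuatara], from [kraft]). The bound is proved for an arbitrary
    self-delimiting [U] since it is used twice: with [U0] for the digits given by
    [unending_expansion_exists], and with the machine of [unary_machine] to show that zeta_W is not
    an integer.

    The diagonal procedure is realized by a Turing machine in two steps. Runs of machines become
    iterations of an arithmetic function on codes of configurations ([run_numE]), and
    [search_machine] provides a Turing machine for the unbounded search of the least stage at which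
    a computable function is nonzero. *)

Set Implicit Arguments.
Unset Strict Implicit.
Unset Printing Implicit Defensive.

(** * From counter machines to Turing machines *)

Section Reach.
Variables (T : Type) (f : T -> option T).

Definition reach n c c' := iter n (obind f) (Some c) = Some c'.

Lemma reachS n c c1 c' : f c = Some c1 -> reach n c1 c' -> reach n.+1 c c'.
Proof. by rewrite /reach iterSr /= => ->. Qed.

Lemma iter_obind_None n : iter n (obind f) None = None.
Proof. by elim: n => //= n ->. Qed.

Lemma reachD m n c c1 c2 :
  reach m c c1 -> reach n c1 c2 -> reach (m + n) c c2.
Proof. by rewrite /reach addnC iterD => ->. Qed.

Lemma reach_halt_le m n c c1 c2 :
  reach m c c1 -> f c1 = None -> reach n c c2 -> n <= m.
Proof.
move=> h1 h2 h3; rewrite leqNgt; apply/negP => lt_mn.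
move: h3; rewrite /reach -(subnK lt_mn) iterD iterS h1 /= h2.
by rewrite iter_obind_None.
Qed.

Lemma reach_halt_inj m n c c1 c2 :
    reach m c c1 -> f c1 = None -> reach n c c2 -> f c2 = None -> c1 = c2.
Proof.
move=> h1 h2 h3 h4.
have e : m = n.
  by apply/eqP; rewrite eqn_leq (reach_halt_le h1 h2 h3) (reach_halt_le h3 h4 h1).
by move: h1; rewrite e /reach h3 => -[].
Qed.

End Reach.

(** Every step is simulated by at least one step, so the simulating run is at least as long; the
    bound [n <= k] is what transfers divergence. *)
Lemma reach_simulation (S T : Type) (f : S -> option S) (g : T -> option T)
    (R : S -> T -> Prop) :
  (forall s s' c, f s = Some s' -> R s c ->
     exists k c', reach g k.+1 c c' /\ R s' c') ->
  forall n s s' c, reach f n s s' -> R s c ->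
     exists k c', [/\ n <= k, reach g k c c' & R s' c'].
Proof.
move=> sim; elim=> [|n IH] s s' c; first by case=> <- Rsc; exists 0, c.
rewrite {1}/reach iterSr /=; case E: (f s) => [s1|]; last by rewrite iter_obind_None.
move=> r Rsc; have [k [c1 [r1 R1]]] := sim _ _ _ E Rsc.
have [k' [c' [le_n r' R']]] := IH _ _ _ r R1.
exists (k.+1 + k'), c'; split=> //; first by rewrite addSn ltnS (leq_trans le_n) ?leq_addl.
exact: reachD r1 r'.
Qed.

Lemma evals_inj (M : machine) x y z : evals M x y -> evals M x z -> y = z.
Proof.
move=> [m [c [h1 h2 <-]]] [n [d [h3 h4 <-]]].
by rewrite (reach_halt_inj h1 h2 h3 h4).
Qed.

(** * Counter machines that read an input word *)

Definition upd (T : Type) (f : nat -> T) i v := fun j => if j == i then v else f j.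

Lemma upd_same (T : Type) (f : nat -> T) i : upd f i (f i) = f.
Proof. by apply/funext => j; rewrite /upd; case: eqP => [->|]. Qed.

Inductive instr :=
  | Inc of nat
  | Djz of nat & nat
  | Jb of bool & nat & nat
  | Jmp of nat & nat.

(* Jumps are relative to the current instruction.  [Djz i f] jumps if the     *)
(* register i is 0 and decrements it otherwise; [Jb b i f] jumps if the input *)
(* has the bit b at the position given by the register i.                     *)
Definition cstep (w : seq bool) (code : seq instr) (c : nat * (nat -> nat)) :
    option (nat * (nat -> nat)) :=
  let: (pc, e) := c in
  if pc < size code then
    Some match nth (Jmp 0 0) code pc with
         | Inc i => (pc.+1, upd e i (e i).+1)
         | Djz i f => if e i == 0 then (pc + f, e) else (pc.+1, upd e i (e i).-1)
         | Jb b i f => (if onth w (e i) == Some b then pc + f else pc.+1, e)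
         | Jmp f b => (pc + f - b, e)
         end
  else None.

Definition reg (i : instr) :=
  match i with Inc i => i | Djz i _ => i | Jb _ i _ => i | Jmp _ _ => 0 end.

Section Tape.
Variable G : finType.

(** The tape is seen as a function on positions 0, 1, 2, ... with the head at [p]. The left part
    consists exactly of the cells before [p], as the simulation never goes left of position 0; the
    right part is determined up to trailing blanks. *)
Definition at_pos p (f : nat -> symbol G) (t : tape G) :=
  tape_left t = rev (mkseq f p) /\
  forall j, nth None (tape_head t :: tape_right t) j = f (p + j).

Lemma at_pos_head p f t : at_pos p f t -> tape_head t = f p.
Proof. by case=> _ /(_ 0); rewrite addn0. Qed.

Lemma eq_mkseq_upd p f (s : symbol G) n :
  n <= p -> mkseq (upd f p s) n = mkseq f n.
Proof.
move=> le_np; apply/eq_in_map => j; rewrite mem_iota /= add0n => lt_jn.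
by rewrite /upd; case: eqP => // jp; lia.
Qed.

Lemma at_pos_stay p f t s :
  at_pos p f t -> at_pos p (upd f p s) (write_move s Stay t).
Proof.
case: t => l h r [/= -> fE]; split=> [|j] /=; first by rewrite eq_mkseq_upd.
rewrite /upd; case: j => [|j] /=; first by rewrite addn0 eqxx.
by have /= -> := fE j.+1; case: eqP => //; lia.
Qed.

Lemma at_pos_right p f t s :
  at_pos p f t -> at_pos p.+1 (upd f p s) (write_move s Right t).
Proof.
case: t => l h r [/= -> fE]; split=> [|j] /=.
  by rewrite mkseqS rev_rcons eq_mkseq_upd // /upd eqxx.
have /= := fE j.+1; rewrite /upd; case: eqP => [|_]; first by lia.
by rewrite addSnnS => <-; case: r {fE} => [|? ?]; case: j => //= j; rewrite nth_nil.
Qed.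

Lemma at_pos_left p f t s :
  at_pos p.+1 f t -> at_pos p (upd f p.+1 s) (write_move s Left t).
Proof.
case: t => l h r [/= -> fE]; split=> [|j] /=.
  by rewrite mkseqS rev_rcons /= eq_mkseq_upd.
rewrite mkseqS rev_rcons /=; case: j => [|[|j]] /=.
- by rewrite addn0 /upd; case: eqP => //; lia.
- by rewrite addn1 /upd eqxx.
have /= := fE j.+1; rewrite /upd; case: eqP => [|_]; first by lia.
by move->; congr f; lia.
Qed.

End Tape.


(** * The Turing machine that runs a counter program *)

Inductive phase := Read0 | Read | Return | Seek | Dec | Write | Stop.

Definition phase_rank (p : phase) : 'I_7 :=
  inord match p with
        | Read0 => 0 | Read => 1 | Return => 2 | Seek => 3
        | Dec => 4 | Write => 5 | Stop => 6
        end.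

Definition phase_unrank (n : 'I_7) : phase :=
  nth Read0 [:: Read0; Read; Return; Seek; Dec; Write; Stop] n.

Lemma phase_rankK : cancel phase_rank phase_unrank.
Proof. by case; rewrite /phase_unrank inordK. Qed.

HB.instance Definition _ := Finite.copy phase (can_type phase_rankK).

Section Compile.
Variables (K out : nat) (code : seq instr).
Hypothesis reg_code : all (fun i => reg i <= K) code.
Hypothesis out_le : out <= K.

(* A cell at position j >= 0 records whether j = 0, the j-th input bit, and   *)
(* for each register whether its value exceeds j.                             *)
Definition cell : finType := (bool * option bool * {ffun 'I_K.+1 -> bool})%type.

(** A blank stands for a cell beyond the input with all tracks empty, so the untouched part of the
    tape already represents the registers correctly. *)
Definition cell_of (s : symbol cell) : cell :=
  if s is Some (inr c) then c else (false, None, [ffun=> false]).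

Definition bit_of (s : symbol cell) : option bool :=
  if s is Some (inl b) then Some b else None.

Definition set_mark (c : cell) i b : symbol cell :=
  Some (inr (c.1, [ffun j => if j == inord i then b else c.2 j])).

Local Notation n := (size code).

(** All program counters from [n] on mean that the program has stopped, so they are identified and
    finitely many states suffice. *)
Definition goto (pc : nat) : 'I_n.+1 := inord (minn n pc).

Definition trans (q : phase * 'I_n.+1) (s : symbol cell) :
    option (phase * 'I_n.+1 * symbol cell * direction) :=
  let c := cell_of s in
  let: (ph, pc) := q in
  match ph with
  | Read0 => Some (Read, pc, Some (inr (true, bit_of s, [ffun=> false])), Right)
  | Read => if bit_of s is Some b
            then Some (Read, pc, Some (inr (false, Some b, [ffun=> false])), Right)
            else Some (Return, pc, s, Stay)
  | Return => if c.1.1 then Some (Seek, pc, s, Stay) else Some (Return, pc, s, Left)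
  | Seek =>
    if (pc < n)%N then
      let i := nth (Jmp 0 0) code pc in
      if i is Jmp f b then Some (Return, goto (pc + f - b), s, Stay)
      else if c.2 (inord (reg i)) then Some (Seek, pc, s, Right)
      else match i with
           | Inc i => Some (Return, goto pc.+1, set_mark c i true, Stay)
           | Djz i f => if c.1.1 then Some (Return, goto (pc + f), s, Stay)
                        else Some (Dec, pc, s, Left)
           | Jb b i f => Some (Return, goto (if c.1.2 == Some b then pc + f else pc.+1), s, Stay)
           | Jmp _ _ => None
           end
    else if c.2 (inord out) then Some (Seek, pc, s, Right)
    else if c.1.1 then Some (Stop, pc, None, Stay) else Some (Write, pc, None, Left)
  | Dec => Some (Return, goto pc.+1, set_mark c (reg (nth (Jmp 0 0) code pc)) false, Stay)
  | Write => let s' := Some (inl true) in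
             if c.1.1 then Some (Stop, pc, s', Stay) else Some (Write, pc, s', Left)
  | Stop => None
  end.

Definition compile : machine :=
  @Machine (phase * 'I_n.+1)%type cell (Read0, goto 0) trans.

Implicit Types (f : nat -> symbol cell) (e : nat -> nat) (t : tape cell).

Definition represents w e f :=
  forall j, cell_of (f j) = (j == 0, onth w j, [ffun i : 'I_K.+1 => j < e i]).

Lemma represents_mark w e f p i : i <= K -> represents w e f -> p = e i ->
  represents w (upd e i (e i).+1) (upd f p (set_mark (cell_of (f p)) i true)).
Proof.
move=> iK R pE j; rewrite /upd; case: eqP => [->|ne]; rewrite /= ?R /=.
  congr (_, _); apply/ffunP => k; rewrite !ffunE.
  rewrite -(inj_eq val_inj) /= inordK //; case: eqP => // _; lia.
congr (_, _); apply/ffunP => k; rewrite !ffunE; case: eqP => // ->; lia.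
Qed.

Lemma represents_unmark w e f p i : i <= K -> represents w e f -> e i = p.+1 ->
  represents w (upd e i p) (upd f p (set_mark (cell_of (f p)) i false)).
Proof.
move=> iK R pE j; rewrite /upd; case: eqP => [->|ne]; rewrite /= ?R /=.
  congr (_, _); apply/ffunP => k; rewrite !ffunE.
  rewrite -(inj_eq val_inj) /= inordK //; case: eqP => // _; lia.
congr (_, _); apply/ffunP => k; rewrite !ffunE; case: eqP => // ->; lia.
Qed.

Local Notation mreach := (reach (@step compile)).

Lemma mreachS m q q' s d t p f c : at_pos p f t ->
  trans q (f p) = Some (q', s, d) -> mreach m (q', write_move s d t) c ->
  mreach m.+1 (q, t) c.
Proof. by move=> /at_pos_head <- E; apply: reachS; rewrite /step /= E. Qed.

Lemma reach_return w e f pc p t : represents w e f -> at_pos p f t ->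
  exists t', mreach p.+1 ((Return, pc), t) ((Seek, pc), t') /\ at_pos 0 f t'.
Proof.
move=> R; elim: p t => [|p IH] t A.
  exists (write_move (f 0) Stay t); split.
    by apply: (mreachS A) => //=; rewrite R.
  by have := at_pos_stay (f 0) A; rewrite upd_same.
have := at_pos_left (f p.+1) A; rewrite upd_same => A'.
have [t' [r' At']] := IH _ A'; exists t'; split=> //.
by apply: (mreachS A) r'; rewrite /= R.
Qed.

Definition seeks (pc : 'I_n.+1) :=
  if pc < n then let i := nth (Jmp 0 0) code pc in
                 if i is Jmp _ _ then None else Some (reg i)
  else Some out.

Lemma reach_seek w e f (pc : 'I_n.+1) i t :
  represents w e f -> seeks pc = Some i -> i <= K -> at_pos 0 f t ->
  exists t', mreach (e i) ((Seek, pc), t) ((Seek, pc), t') /\ at_pos (e i) f t'.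
Proof.
move=> R si iK A.
suff: forall p, p <= e i -> exists t', mreach p ((Seek, pc), t) ((Seek, pc), t') /\ at_pos p f t'.
  exact.
elim=> [|p IH] pe; first by exists t.
have [t' [r' A']] := IH (ltnW pe).
exists (write_move (f p) Right t'); split.
  rewrite -addn1; apply: reachD r' _.
  apply: (mreachS A') => //=.
  move: si; rewrite /seeks; case: ifP => // _.
    by case: nth => //= [j|j k|b j k] [->]; rewrite R /= ffunE inordK ?ltnS // pe.
  by case=> ->; rewrite R /= ffunE inordK ?ltnS // pe.
by have := at_pos_right (f p) A'; rewrite upd_same.
Qed.

Definition simulates w (c : nat * (nat -> nat)) (d : config compile) :=
  exists f, [/\ d.1 = (Seek, goto c.1), represents w c.2 f & at_pos 0 f d.2].

Lemma gotoE pc : pc <= n -> goto pc = pc :> nat.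
Proof. by move=> le_pc; rewrite /goto inordK ?ltnS; [apply/minn_idPr | rewrite geq_minl]. Qed.

(** In phase [Seek] the head walks from cell 0 to the first cell without mark on the track of the
    register, whose position is the value of that register. There it tests, marks or reads the input
    bit, and then it returns to cell 0. *)
Lemma compile_step w c c' d : cstep w code c = Some c' -> simulates w c d ->
  exists k d', mreach k.+1 d d' /\ simulates w c' d'.
Proof.
case: c => pc e /=; case: ltnP => // lt_pc [<-] {c'} [f [/=]].
case: d => q t /= -> R A.
have pcE : goto pc = pc :> nat by rewrite gotoE // ltnW.
have iK := all_nthP (Jmp 0 0) reg_code _ lt_pc.
(* The common end of all instructions: once the tape represents the new registers, the head returns
   to cell 0. *)
have back k e' f' pc' p t' : mreach k.+1 ((Seek, goto pc), t) ((Return, goto pc'), t') ->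
    represents w e' f' -> at_pos p f' t' ->
    exists k d', mreach k.+1 ((Seek, goto pc), t) d' /\ simulates w (pc', e') d'.
  move=> r R' A'; have [t2 [r2 A2]] := reach_return (goto pc') R' A'.
  exists (k + p.+1), ((Seek, goto pc'), t2); split; last by exists f'.
  exact: reachD r r2.
have sk i (A1 : seeks (goto pc) = Some i) (iK' : i <= K) := reach_seek R A1 iK' A.
have st j t' : at_pos j f t' -> at_pos j f (write_move (f j) Stay t').
  by move=> A1; have := at_pos_stay (f j) A1; rewrite upd_same.
case E: (nth _ _ _) iK => [i|i j|b i j|j b] /= iK; last first.
- apply: (back 0 e f _ 0 (write_move (f 0) Stay t)) => //; last exact: st.
  by apply: (mreachS A) => //=; rewrite pcE lt_pc E.
- have [|t1 [r1 A1]] := sk i _ iK; first by rewrite /seeks pcE lt_pc E.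
  apply: (back (e i) e f _ (e i) (write_move (f (e i)) Stay t1)) => //; last exact: st.
  rewrite -addn1; apply: (reachD r1); apply: (mreachS A1) => //=.
  by rewrite pcE lt_pc E R /= ffunE inordK ?ltnS // ltnn.
- have [|t1 [r1 A1]] := sk i _ iK; first by rewrite /seeks pcE lt_pc E.
  case ei: (e i) r1 A1 => [|p] r1 A1 /=.
    apply: (back 0 e f _ 0 (write_move (f 0) Stay t1)) => //; last exact: st.
    rewrite -(addn0 1) addnC; apply: (reachD r1); apply: (mreachS A1) => //=.
    by rewrite pcE lt_pc E R /= ffunE inordK ?ltnS // ei.
  (* The head is on the first unmarked cell, so the mark to erase is one cell to the left. *)
  set t2 := write_move (f p.+1) Left t1.
  have A2 : at_pos p f t2 by have := at_pos_left (f p.+1) A1; rewrite upd_same.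
  apply: (back p.+2 _ (upd f p (set_mark (cell_of (f p)) i false)) _ p
    (write_move (set_mark (cell_of (f p)) i false) Stay t2)).
  - rewrite -[p.+3]addn2; apply: (reachD r1); apply: (@mreachS 1 _ (Dec, goto pc) (f p.+1) Left _ _ _ _ A1).
      by rewrite /= pcE lt_pc E R /= ffunE inordK ?ltnS // ei ltnn.
    by apply: (mreachS A2) => //=; rewrite pcE E.
  - exact: represents_unmark.
  - exact: at_pos_stay.
- have [|t1 [r1 A1]] := sk i _ iK; first by rewrite /seeks pcE lt_pc E.
  apply: (back (e i) _ (upd f (e i) (set_mark (cell_of (f (e i))) i true)) _ (e i)
    (write_move (set_mark (cell_of (f (e i))) i true) Stay t1)).
  - rewrite -addn1; apply: (reachD r1); apply: (mreachS A1) => //=.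
    by rewrite pcE lt_pc E R /= ffunE inordK ?ltnS // ltnn.
  - exact: represents_mark.
  - exact: at_pos_stay.
Qed.

Lemma compile_load w :
  exists k d, mreach k (@init compile w) d /\ simulates w (0, fun=> 0) d.
Proof.
pose f0 j : symbol cell := if onth w j is Some b then Some (inl b) else None.
pose f p j : symbol cell :=
  if j < p then Some (inr (j == 0, onth w j, [ffun=> false])) else f0 j.
have init_at : at_pos 0 (f 0) (init compile w).2.
  split=> // j; rewrite add0n /f /f0 ltn0 /=.
  by case: w {f0 f} => [|a w]; case: j => //= j; rewrite ?nth_nil //; elim: w j => [|b w IH] [|j] //=.
have bitE p : bit_of (f p p) = onth w p.
  by rewrite /f ltnn /f0; case: onth.
have fS p : upd (f p) p (Some (inr (p == 0, onth w p, [ffun=> false]))) = f p.+1.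
  by apply/funext => j; rewrite /upd /f ltnS [j <= p]leq_eqVlt; case: eqP => [->|_].
(* [f p] is the tape after [p] cells have been converted. Cell 0 is converted even when the input is
   empty, whence the maximum with 1. *)
have load p : p < maxn 1 (size w) ->
  exists t, mreach p.+1 (@init compile w) ((Read, goto 0), t) /\ at_pos p.+1 (f p.+1) t.
  elim: p => [_|p IH lt_p].
    eexists; split; first exact: (mreachS init_at).
    by rewrite -fS -bitE; exact: at_pos_right.
  have [t [r A]] := IH (ltnW lt_p).
  have [b E] : exists b, onth w p.+1 = Some b.
    case E: (onth w p.+1) => [b|]; first by exists b.
    have lt_w : p.+1 < size w by lia.
    by have := onthTE w p.+1; rewrite E lt_w.
  have At := at_pos_right (Some (inr (p.+1 == 0, onth w p.+1, [ffun=> false]))) A.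
  rewrite fS in At; exists (write_move (Some (inr (p.+1 == 0, onth w p.+1, [ffun=> false]))) Right t); split=> //.
  rewrite -[p.+2]addn1; apply: (reachD r); apply: (mreachS A) => //.
  by rewrite [LHS]/= bitE E.
have [t [r A]] : exists t, mreach (maxn 1 (size w)) (@init compile w) ((Read, goto 0), t) /\
    at_pos (maxn 1 (size w)) (f (maxn 1 (size w))) t.
  have := load (maxn 1 (size w)).-1; rewrite prednK ?leq_max // -leq_max leqnn; exact.
set m := maxn 1 (size w) in r A *.
have wm j : m <= j -> onth w j = None by rewrite geq_max => /andP[_ /onth_default].
have Rf : represents w (fun=> 0) (f m).
  move=> j; have -> : [ffun i : 'I_K.+1 => j < 0] = [ffun=> false] by apply/ffunP => i; rewrite !ffunE.
  rewrite /f; case: ltnP => //= le_mj; rewrite /f0 wm //=; congr (_, _, _).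
  by apply/esym/negbTE; rewrite -lt0n (leq_trans _ le_mj) // leq_max.
have At := at_pos_stay (f m m) A; rewrite upd_same in At.
have [t' [r' A']] := reach_return (goto 0) Rf At.
exists (m + m.+2), ((Seek, goto 0), t'); split; last by exists (f m).
by apply: (reachD r); apply: (mreachS A) r'; rewrite /= bitE wm.
Qed.

Lemma leading_bits_nseq (l : seq (symbol cell)) m :
  (forall j, j < m -> nth None l j = Some (inl true)) -> nth None l m = None ->
  leading_bits l = nseq m true.
Proof.
elim: m l => [|m IH] [|s l] lt_m eq_m //=.
- by move: eq_m => /= ->.
- by have := lt_m 0 isT.
have /= -> := lt_m 0 isT; congr cons.
by apply: IH => // j; exact: (lt_m j.+1).
Qed.

(** Ones are written from right to left, because the flag of cell 0 is what ends this phase; the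
    blank in cell [m] delimits the output. *)
Lemma reach_write m f pc p t : p < m -> at_pos p f t ->
  (forall j, j <= p -> (cell_of (f j)).1.1 = (j == 0)) ->
  (forall j, p < j < m -> f j = Some (inl true)) -> f m = None ->
  exists k t', mreach k ((Write, pc), t) ((Stop, pc), t') /\
    @output compile ((Stop, pc), t') = nseq m true.
Proof.
elim: p f t => [|p IH] f t lt_pm A flag ones none.
  exists 1, (write_move (Some (inl true)) Stay t); split.
    by apply: (mreachS A) => //=; rewrite flag.
  have [_ E] := at_pos_stay (Some (inl true)) A.
  apply: leading_bits_nseq => [j lt_jm|]; rewrite E add0n /upd.
    by case: eqP => // /eqP; rewrite -lt0n => j0; rewrite ones ?j0.
  by case: eqP => // m0; rewrite m0 in lt_pm.
have [|||k [t' [r O]]] := IH _ _ (ltnW lt_pm) (at_pos_left (Some (inl true)) A).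
- move=> j le_jp; rewrite /upd; case: eqP => [jp|_]; last by apply: flag; lia.
  by rewrite jp ltnn in le_jp.
- move=> j /andP[lt_pj lt_jm]; rewrite /upd; case: eqP => // jp; apply: ones.
  by rewrite lt_jm andbT ltn_neqAle lt_pj eq_sym; move/eqP: jp => ->.
- by rewrite /upd; case: eqP => // mp; rewrite mp ltnn in lt_pm.
exists k.+1, t'; split=> //; apply: (mreachS A) r.
by rewrite /= flag.
Qed.

Lemma compile_output w e d : simulates w (n, e) d ->
  exists k d', [/\ mreach k d d', step d' = None & output d' = nseq (e out) true].
Proof.
case: d => q t [f [/= -> R A]].
have pcE := gotoE (leqnn n).
have sE : seeks (goto n) = Some out by rewrite /seeks pcE ltnn.
have [t1 [r1 A1]] := reach_seek R sE out_le A.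
case eo: (e out) r1 A1 => [|p] r1 A1.
  exists 1, ((Stop, goto n), write_move None Stay t1); split=> //.
    rewrite -[1]add0n; apply: (reachD r1); apply: (mreachS A1) => //=.
    by rewrite pcE ltnn R /= ffunE inordK ?ltnS // eo.
  have [_ E] := at_pos_stay None A1.
  by apply: leading_bits_nseq => //; rewrite E.
have [|||k [t' [r O]]] := reach_write (goto n) (ltnSn p) (at_pos_left None A1).
- move=> j le_jp; rewrite /upd; case: eqP => [jp|_]; last by rewrite R.
  by rewrite jp ltnn in le_jp.
- by move=> j; lia.
- by rewrite /upd eqxx.
exists (p.+1 + k.+1), ((Stop, goto n), t'); split=> //.
apply: (reachD r1); apply: (mreachS A1) r.
by rewrite /= pcE ltnn R /= ffunE inordK ?ltnS // eo ltnn.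
Qed.

Lemma compile_evals w k e :
  reach (cstep w code) k (0, fun=> 0) (n, e) -> evals compile w (nseq (e out) true).
Proof.
have [k0 [d0 [r0 S0]]] := compile_load w.
move=> /(reach_simulation (@compile_step w)) /(_ S0) [k1 [d1 [_ r1 S1]]].
have [k2 [d2 [r2 h O]]] := compile_output S1.
by exists (k0 + (k1 + k2)), d2; split=> //; apply: (reachD r0); apply: (reachD r1).
Qed.

(** A halting run bounds the length of every run from the same configuration, while the simulation
    provides runs of any length. *)
Lemma compile_diverges w :
  (forall k, exists2 k', k <= k' & exists c, reach (cstep w code) k' (0, fun=> 0) c) ->
  ~ dom compile w.
Proof.
move=> run [y [k [d [r h _]]]].
have [k0 [d0 [r0 S0]]] := compile_load w.
have [k' lt_k [c /(reach_simulation (@compile_step w)) /(_ S0)]] := run k.+1.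
move=> [k1 [d1 [le_k r1 _]]].
by have := reach_halt_le r h (reachD r0 r1); lia.
Qed.

End Compile.

(** * Computable functions *)

(** The surrounding program is arbitrary: with relative jumps, fragments can then be composed by
    concatenation. *)
Definition runs w code e e' := forall pre post, exists n,
  reach (cstep w (pre ++ code ++ post)) n (size pre, e) (size pre + size code, e').

Lemma cstep_cat w pre code post j e : j < size code ->
  cstep w (pre ++ code ++ post) (size pre + j, e) =
  if cstep w code (j, e) is Some (_, e') then
    Some (match nth (Jmp 0 0) code j with
          | Inc i => size pre + j.+1
          | Djz i f => size pre + j + if e i == 0 then f else 1
          | Jb b i f => size pre + j + if onth w (e i) == Some b then f else 1
          | Jmp f b => size pre + j + f - b
          end, e')
  else None.
Proof.
move=> lt_j; rewrite /cstep lt_j !size_cat ltn_add2l ltn_addr //.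
rewrite nth_cat ltnNge leq_addr /= addKn nth_cat lt_j.
by case: nth => [i|i f|b i f|f b]; rewrite ?addnS //; case: eqP; rewrite ?addn1 ?addnS ?addn0.
Qed.

Lemma runs_nil w e : runs w [::] e e.
Proof. by move=> pre post; exists 0; rewrite addn0. Qed.

Lemma runs_cat w c1 c2 e e1 e2 :
  runs w c1 e e1 -> runs w c2 e1 e2 -> runs w (c1 ++ c2) e e2.
Proof.
move=> r1 r2 pre post.
have [n1 h1] := r1 pre (c2 ++ post); have [n2 h2] := r2 (pre ++ c1) post.
exists (n1 + n2); rewrite -catA; apply: reachD h1 _.
by move: h2; rewrite !size_cat addnA -!catA.
Qed.

Lemma runs_inc w i e : runs w [:: Inc i] e (upd e i (e i).+1).
Proof.
move=> pre post; exists 1; apply: (@reachS _ _ 0 _ _ _ _ erefl).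
by rewrite -{1}[size pre]addn0 cstep_cat.
Qed.

Definition loop i c := Djz i (size c).+2 :: c ++ [:: Jmp 0 (size c).+1].

(** The invariant is indexed by the value of the loop counter, which is already decremented when the
    body starts. *)
Lemma runs_loop w i c (I : nat -> (nat -> nat) -> Prop) :
  (forall k e, I k e -> e i = k) ->
  (forall k e, I k.+1 e -> exists e', runs w c (upd e i k) e' /\ I k e') ->
  forall k e, I k e -> exists e', runs w (loop i c) e e' /\ I 0 e'.
Proof.
move=> Ii Ic; elim=> [|k IH] e Ie.
  exists e; split=> // pre post; exists 1; apply: (@reachS _ _ 0 _ _ _ _ erefl).
  rewrite -{1}[size pre]addn0 cstep_cat //= (Ii _ _ Ie) eqxx.
  by rewrite size_cat addn0 /= addn1.
have [e1 [r1 I1]] := Ic _ _ Ie; have [e2 [r2 I2]] := IH _ I1.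
exists e2; split=> // pre post.
have [n1 h1] := r1 (pre ++ [:: Djz i (size c).+2]) ([:: Jmp 0 (size c).+1] ++ post).
have [n2 h2] := r2 pre post.
exists (n1 + n2.+1).+1; apply: (@reachS _ _ _ _ (size pre + 1, upd e i k)).
  by rewrite -{1}[size pre]addn0 cstep_cat //= (Ii _ _ Ie) addn0.
have E : pre ++ loop i c ++ post =
    (pre ++ [:: Djz i (size c).+2]) ++ c ++ [:: Jmp 0 (size c).+1] ++ post.
  by rewrite /loop /= -!catA.
apply: (reachD (c1 := (size pre + (size c).+1, e1))).
  by move: h1; rewrite -E size_cat /= addn1 addSnnS.
apply: reachS h2; rewrite cstep_cat; last by rewrite /= size_cat addn1.
rewrite /cstep /= size_cat addn1 ltnS leqnn nth_cat ltnn subnn /=.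
by rewrite addn0 addnK.
Qed.

Lemma upd_upd (T : Type) (e : nat -> T) i u v : upd (upd e i u) i v = upd e i v.
Proof. by apply/funext => j; rewrite /upd; case: eqP. Qed.

Definition clear i := loop i [::].

Lemma runs_clear w i e : runs w (clear i) e (upd e i 0).
Proof.
have [|||e' [r E]] // := @runs_loop w i [::] (fun k e' => e' = upd e i k) _ _ (e i) e.
- by move=> k _ ->; rewrite /upd eqxx.
- by move=> k _ ->; exists (upd e i k); rewrite upd_upd; split=> //; apply: runs_nil.
- by rewrite upd_same.
by rewrite -E.
Qed.

Definition move_reg i j := clear j ++ loop i [:: Inc j].

Lemma runs_move w i j e : i != j ->
  runs w (move_reg i j) e (upd (upd e j (e i)) i 0).
Proof.
move=> /eqP ne; apply: runs_cat (runs_clear w j e) _.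
have [|||e' [r [_ E]]] // := @runs_loop w i [:: Inc j]
    (fun k e' => k <= e i /\ e' = upd (upd e j (e i - k)) i k) _ _ (e i) (upd e j 0).
- by move=> k _ [_ ->]; rewrite /upd eqxx.
- move=> k _ [lt_k ->].
  eexists; split; first exact: runs_inc.
  split; first exact: ltnW.
  apply/funext => l; rewrite /upd; do ?case: eqP => //; lia.
- split=> //; rewrite subnn; apply/funext => l; rewrite /upd; do ?case: eqP => //; congruence.
by rewrite subn0 in E; rewrite -E.
Qed.

Definition copy_reg i j k :=
  clear j ++ clear k ++ loop i [:: Inc j; Inc k] ++ move_reg k i.

Lemma runs_copy w i j k e : i != j -> i != k -> j != k ->
  runs w (copy_reg i j k) e (upd (upd e j (e i)) k 0).
Proof.
move=> /eqP ij /eqP ik /eqP jk; apply: runs_cat (runs_clear w j e) _.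
apply: runs_cat (runs_clear w k _) _.
have [|||e' [r [_ E]]] // := @runs_loop w i [:: Inc j; Inc k]
    (fun n e' => n <= e i /\ e' = upd (upd (upd e j (e i - n)) k (e i - n)) i n) _ _
    (e i) (upd (upd e j 0) k 0).
- by move=> n _ [_ ->]; rewrite /upd eqxx.
- move=> n _ [lt_n ->].
  eexists; split; first exact: (runs_cat (c1 := [:: _]) (runs_inc w j _) (runs_inc w k _)).
  split; first exact: ltnW.
  apply/funext => l; rewrite /upd; do ?case: eqP => //; lia.
- split=> //; rewrite subnn; apply/funext => l; rewrite /upd; do ?case: eqP => //; congruence.
apply: runs_cat r _.
have := runs_move w e' (introN eqP (nesym ik)); rewrite E subn0.
congr runs; apply/funext => l; rewrite /upd; do ?case: eqP => //; congruence.
Qed.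

(** * Computable functions of a word and several numbers *)

(** The input word with [s] numbers. A bound variable, such as a summation index, is appended as the
    last component. *)
Fixpoint ctx s : Type := if s is s'.+1 then (ctx s' * nat)%type else seq bool.

Fixpoint word s : ctx s -> seq bool :=
  if s is s'.+1 then fun x => word x.1 else id.

Fixpoint holds s : ctx s -> (nat -> nat) -> Prop :=
  if s is s'.+1 then fun x v => holds x.1 v /\ v s' = x.2 else fun _ _ => True.

Lemma eq_holds s (x : ctx s) u v :
  (forall i, i < s -> u i = v i) -> holds x u -> holds x v.
Proof.
elim: s x => //= s IH [x n] /= uv [h <-]; split; last by rewrite uv.
by apply: IH h => i /ltnW/uv.
Qed.

(* The registers from [t] on are scratch space: since [t] and the positions   *)
(* [a] of the arguments are arbitrary, programs can be nested without         *)
(* renaming registers.                                                        *)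
Definition computable s (f : ctx s -> nat) := forall a t, (forall i, i < s -> a i < t) ->
  exists code, forall x e, holds x (e \o a) ->
  exists e', [/\ runs (word x) code e e', e' t = f x & forall i, i < t -> e' i = e i].

Lemma eq_computable s (f g : ctx s -> nat) : f =1 g -> computable f -> computable g.
Proof. by move=> /funext ->. Qed.

Lemma computable_var s : computable (fun x : ctx s.+1 => x.2).
Proof.
move=> a t lt_at; exists (copy_reg (a s) t t.+1) => x e [_ /= <-].
have lt_t := lt_at s (ltnSn s).
eexists; split; first by apply: runs_copy; lia.
- by rewrite /upd eqxx; case: eqP => // /eqP; rewrite eqn_leq ltnn andbF.
- by move=> i lt_i; rewrite /upd; do ?case: eqP => //; lia.
Qed.

Lemma computable_weak s (f : ctx s -> nat) : computable f -> computable (fun x : ctx s.+1 => f x.1).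
Proof.
move=> cf a t lt_at; have [|code run] := cf a t; first by move=> i /ltnW/lt_at.
by exists code => x e [/run].
Qed.

Lemma computable_drop s (f : ctx s.+1 -> nat) :
  computable f -> computable (fun y : ctx s.+2 => f (y.1.1, y.2)).
Proof.
(* The code of [f] is reused with its last variable read from the register of the variable
   [s.+1]. *)
move=> cf a t lt_at; have [|code run] := cf (upd a s (a s.+1)) t.
  by move=> i lt_i; rewrite /upd; case: eqP => _; apply: lt_at; lia.
exists code => x e [[h _] <-]; apply: (run (x.1.1, e (a s.+1)) e).
split=> /=; last by rewrite /upd eqxx.
by apply: eq_holds h => i lt_i /=; rewrite /upd; case: eqP => //; lia.
Qed.

Lemma computable_const s n : computable (fun _ : ctx s => n).
Proof.
move=> a t _; exists (clear t ++ nseq n (Inc t)) => x e _.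
have [e' [r et lt_t]] : exists e', [/\ runs (word x) (clear t ++ nseq n (Inc t)) e e',
    e' t = n & forall i, i < t -> e' i = e i]; last by exists e'.
elim: n => [|n [e' [r et lt_t]]].
  exists (upd e t 0); split; first by rewrite cats0; apply: runs_clear.
    by rewrite /upd eqxx.
  by move=> i lt_i; rewrite /upd; case: eqP => //; lia.
exists (upd e' t (e' t).+1); split.
- by rewrite -addn1 nseqD catA; apply: runs_cat r (runs_inc _ _ _).
- by rewrite /upd eqxx et.
- by move=> i lt_i; rewrite /upd; case: eqP => [|_]; [lia | exact: lt_t].
Qed.

Lemma computable_succ s (f : ctx s -> nat) : computable f -> computable (fun x => (f x).+1).
Proof.
move=> cf a t /cf [code run]; exists (code ++ [:: Inc t]) => x e /run [e' [r et lt_t]].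
exists (upd e' t (e' t).+1); split; first exact: runs_cat r (runs_inc _ _ _).
- by rewrite /upd eqxx et.
- by move=> i lt_i; rewrite /upd; case: eqP => [|_]; [lia | exact: lt_t].
Qed.

Fixpoint nrec n z (f : nat -> nat -> nat) :=
  if n is n'.+1 then f n' (nrec n' z f) else z.

Lemma computable_rec s (b g : ctx s -> nat) (h : ctx s -> nat -> nat -> nat) :
  computable b -> computable g -> computable (fun y : ctx s.+2 => h y.1.1 y.1.2 y.2) ->
  computable (fun x => nrec (b x) (g x) (h x)).
Proof.
move=> cb cg ch a t lt_at; have [c1 run1] := cg a t lt_at.
have [|c2 run2] := cb a t.+2; first by move=> i /lt_at lt_i; lia.
have [|c3 run3] := ch (upd (upd a s t.+1) s.+1 t) t.+3.
  move=> i lt_i; rewrite /upd; do ?case: eqP; try lia.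
  by move=> ? ?; have := lt_at i; lia.
(* Register [t] is the accumulator, [t.+1] the recursion index, [t.+2] the number of rounds left,
   and [t.+3] receives the value of [h]. *)
exists (c1 ++ clear t.+1 ++ c2 ++ loop t.+2 (c3 ++ move_reg t.+3 t ++ [:: Inc t.+1])) => x e hx.
have [e1 [r1 et1 lt1]] := run1 x e hx.
have [|e2 [r2 et2 lt2]] := run2 x (upd e1 t.+1 0).
  apply: eq_holds hx => i /lt_at lt_i /=; rewrite /upd; case: eqP => [|_]; first lia.
  by rewrite lt1.
have [||| e' [r [_ _ _ et lt]]] := @runs_loop (word x) t.+2 (c3 ++ move_reg t.+3 t ++ [:: Inc t.+1])
  (fun k e' => [/\ k <= b x, e' t.+2 = k, e' t.+1 = b x - k, e' t = nrec (b x - k) (g x) (h x) &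
     forall i, i < t -> e' i = e i]) _ _ (b x) e2.
- by move=> k e' [].
- move=> k e3 [lt_k e32 e31 e30 e3lt].
  have [|e4 [r4 et4 lt4]] := run3 (x, b x - k.+1, nrec (b x - k.+1) (g x) (h x)) (upd e3 t.+2 k).
    split; last by rewrite /= /upd eqxx; case: eqP => //; lia.
    split; last by rewrite /= /upd eqxx; do ?case: eqP => //; lia.
    apply: eq_holds hx => i lt_i /=; have := lt_at i lt_i.
    rewrite /upd; do ?case: eqP; try lia.
    by move=> *; rewrite e3lt.
  eexists; split.
    by apply: (runs_cat r4); apply: runs_cat (runs_inc _ _ _); apply: runs_move; lia.
  have lt4' i : i < t.+3 -> i <> t.+2 -> e4 i = e3 i.
    by move=> /lt4 ->; rewrite /upd; case: eqP.
  split; first exact: ltnW.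
  + rewrite /upd; do ?case: eqP; try lia.
    by move=> *; rewrite lt4 // /upd eqxx.
  + rewrite /upd eqxx; do ?case: eqP; try lia.
    by move=> *; rewrite lt4' //; lia.
  + rewrite /upd eqxx; do ?case: eqP; try lia.
    by move=> *; rewrite et4 -(subnSK lt_k).
  + move=> i lt_i; rewrite /upd; do ?case: eqP; try lia.
    by move=> *; rewrite lt4' ?e3lt //; lia.
- split=> //; rewrite ?subnn.
  + by rewrite lt2 // /upd eqxx.
  + by rewrite lt2 ?ltnS // /upd; case: eqP => //; lia.
  + move=> i lt_i; rewrite lt2 ?ltnS 1?ltnW 1?ltnW // /upd; case: eqP => [|_]; first lia.
    exact: lt1.
exists e'; split=> //; last by rewrite et subn0.
apply: (runs_cat r1); apply: (runs_cat (runs_clear _ _ _)); exact: runs_cat r2 r.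
Qed.

(** The value 0 marks positions beyond the input, so that its end can be detected. *)
Definition bit_code (b : option bool) : nat := if b is Some b then b.+1 else 0.

Lemma computable_input s (f : ctx s -> nat) :
  computable f -> computable (fun x => bit_code (onth (word x) (f x))).
Proof.
move=> cf a t /cf [code run].
(* The jumps enter the pair of [Inc] at the first one for the bit 1, at the second one for the bit
   0, and skip both beyond the input. *)
exists (code ++ clear t.+1 ++ [:: Jb true t 3; Jb false t 3; Jmp 3 0; Inc t.+1; Inc t.+1]
   ++ move_reg t.+1 t) => x e /run [e' [r et lt_t]].
eexists; split.
- apply: (runs_cat r); apply: (runs_cat (runs_clear _ _ _)).
  apply: (@runs_cat _ _ _ _ (upd e' t.+1 (bit_code (onth (word x) (f x))))).
    set c := [:: _; _; _; _; _].
    move=> pre post.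
    set e1 := upd e' t.+1 0.
    have e1t : e1 t = f x by rewrite -et /e1 /upd; case: eqP => //; lia.
    have e1t1 : e1 t.+1 = 0 by rewrite /e1 /upd eqxx.
    have fin v : Some (size pre + 5, upd e1 t.+1 v) = Some (size pre + size c, upd e' t.+1 v).
      by rewrite /e1 upd_upd.
    have e1_same : upd e1 t.+1 0 = e1 by rewrite -e1t1 upd_same.
    case E: (onth (word x) (f x)) => [[]|].
    + exists 3; apply: (@reachS _ _ _ _ (size pre + 3, e1)).
        by rewrite -{1}[size pre]addn0 cstep_cat //= e1t E eqxx addn0.
      apply: (@reachS _ _ _ _ (size pre + 4, upd e1 t.+1 1)); first by rewrite cstep_cat //= e1t1.
      apply: (@reachS _ _ 0 _ (size pre + 5, upd e1 t.+1 2)); last exact: fin.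
      by rewrite cstep_cat //= upd_upd /upd eqxx.
    + exists 3; apply: (@reachS _ _ _ _ (size pre + 1, e1)).
        by rewrite -{1}[size pre]addn0 cstep_cat //= e1t E addn0.
      apply: (@reachS _ _ _ _ (size pre + 4, e1)).
        by rewrite cstep_cat //= e1t E eqxx -addnA.
      apply: (@reachS _ _ 0 _ (size pre + 5, upd e1 t.+1 1)); last exact: fin.
      by rewrite cstep_cat //= e1t1.
    + exists 3; apply: (@reachS _ _ _ _ (size pre + 1, e1)).
        by rewrite -{1}[size pre]addn0 cstep_cat //= e1t E addn0.
      apply: (@reachS _ _ _ _ (size pre + 2, e1)).
        by rewrite cstep_cat //= e1t E -addnA.
      apply: (@reachS _ _ 0 _ (size pre + 5, upd e1 t.+1 0)); last exact: fin.
      by rewrite cstep_cat //= subn0 -addnA e1_same.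
  by apply: runs_move; rewrite neq_ltn ltnSn orbT.
- by rewrite /upd eqxx eqxx; case: eqP => //; lia.
- by move=> i lt_i; rewrite /upd; do ?case: eqP; try lia; move=> *; exact: lt_t.
Qed.

Lemma reg_le_bigmax code : all (fun i => reg i <= foldr maxn 1 (map reg code)) code.
Proof.
elim: code => //= i code IH; rewrite leq_maxl /=.
by apply: sub_all IH => j; rewrite leq_max orbC => ->.
Qed.

Lemma bigmax_gt0 s : 0 < foldr maxn 1 s.
Proof. by elim: s => //= n s IH; rewrite leq_max IH orbT. Qed.

(** The only unbounded search of the development. Register 0 holds the candidate [t]; the programs
    of [P] and [L] preserve it, as their scratch space starts at register 1. *)
Lemma search_machine (P L : ctx 1 -> nat) : computable P -> computable L ->
  exists M, forall w,
    (forall t, P (w, t) <> 0 -> (forall u, u < t -> P (w, u) = 0) ->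
       evals M w (nseq (L (w, t)) true)) /\
    ((forall t, P (w, t) = 0) -> ~ dom M w).
Proof.
move=> cP cL.
have [|cp runP] := cP id 1; first by case.
have [|cl runL] := cL id 1; first by case.
(* If [P] is 0 the candidate is increased and control goes back to instruction 0; otherwise
   [Jmp 3 0] leads to the code of [L]. *)
pose tl := [:: Djz 1 2; Jmp 3 0; Inc 0; Jmp 0 (size cp + 3)].
pose code := cp ++ tl ++ cl.
have next w e : P (w, e 0) = 0 -> exists n e',
    reach (cstep w code) n.+1 (0, e) (0, e') /\ e' 0 = (e 0).+1.
  move=> P0; have [//|e1 [r1 e11 e10]] := runP (w, e 0) e.
  have [n1 h1] : exists n, reach (cstep w code) n (0, e) (size cp, e1) := r1 [::] (tl ++ cl).
  exists (n1 + 2), (upd e1 0 (e1 0).+1); split; last by rewrite /upd eqxx e10.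
  rewrite -addnS; apply: (reachD h1).
  have st := cstep_cat w cp cl.
  apply: (@reachS _ _ _ _ (size cp + 2, e1)).
    by rewrite -{1}[size cp]addn0 (st tl) //= e11 P0 eqxx addn0.
  apply: (@reachS _ _ _ _ (size cp + 3, upd e1 0 (e1 0).+1)); first by rewrite (st tl).
  apply: (@reachS _ _ 0 _ (0, upd e1 0 (e1 0).+1)) => //.
  by rewrite (st tl) //= addn0 subnn.
have stop w e : P (w, e 0) <> 0 -> exists n e',
    reach (cstep w code) n (0, e) (size code, e') /\ e' 1 = L (w, e 0).
  move=> /eqP P0; have [//|e1 [r1 e11 e10]] := runP (w, e 0) e.
  have [n1 h1] : exists n, reach (cstep w code) n (0, e) (size cp, e1) := r1 [::] (tl ++ cl).
  pose e2 := upd e1 1 (e1 1).-1.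
  have [|e3 [r3 e31 e30]] := runL (w, e 0) e2; first by rewrite /= /e2 /upd /= e10.
  have [n3 h3] := r3 (cp ++ tl) [::].
  exists (n1 + n3.+2), e3; split=> //.
  apply: (reachD h1).
  have st := cstep_cat w cp cl.
  apply: (@reachS _ _ _ _ (size cp + 1, e2)).
    by rewrite -{1}[size cp]addn0 (st tl) //= /e2 e11 (negbTE P0) addn0.
  apply: (@reachS _ _ _ _ (size cp + 4, e2)); first by rewrite (st tl) //= subn0 -addnA.
  by move: h3; rewrite cats0 !size_cat /= -catA addnA.
exists (compile (foldr maxn 1 (map reg code)) 1 code) => w.
have search t : (forall u, u < t -> P (w, u) = 0) -> exists n e,
    [/\ t <= n, reach (cstep w code) n (0, fun=> 0) (0, e) & e 0 = t].
  elim: t => [|t IH] P0; first by exists 0, (fun=> 0).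
  have [u lt_u|n [e [le_n r e0]]] := IH; first exact/P0/ltnW.
  have [|n' [e' [r' e'0]]] := next w e; first by rewrite e0 P0.
  exists (n + n'.+1), e'; split; [lia | exact: reachD r r' | by rewrite e'0 e0].
split=> [t Pt P0|P0].
  have [n [e [_ r e0]]] := search t P0.
  have [|n' [e' [r' E]]] := stop w e; first by rewrite e0.
  rewrite e0 in E; rewrite -E; apply: (compile_evals (reg_le_bigmax _) (bigmax_gt0 _)).
  exact: reachD r r'.
apply: (compile_diverges (reg_le_bigmax _) (bigmax_gt0 _)) => k.
have [//|n [e [le_n r _]]] := search k.
by exists n => //; exists (0, e).
Qed.

(** * Arithmetic functions *)

Lemma computable_weak2 s (f : ctx s -> nat) : computable f -> computable (fun x : ctx s.+2 => f x.1.1).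
Proof. by move=> cf; apply: (@computable_weak s.+1 (fun x => f x.1)); apply: computable_weak. Qed.

Lemma computable_var1 s : computable (fun x : ctx s.+2 => x.1.2).
Proof. exact: (@computable_weak s.+1 (fun x => x.2) (@computable_var s)). Qed.

Lemma computable_var2 s : computable (fun x : ctx s.+3 => x.1.1.2).
Proof. exact: (@computable_weak2 s.+1 (fun x => x.2) (@computable_var s)). Qed.

Section Arithmetic.
Variable s : nat.
Implicit Types (f g b : ctx s -> nat).

Lemma computable_add f g : computable f -> computable g -> computable (fun x => f x + g x).
Proof.
move=> cf cg; apply: (@eq_computable _ (fun x => nrec (f x) (g x) (fun _ a => a.+1))).
  by move=> x; elim: (f x) => //= n ->; rewrite addSn.
by apply: (@computable_rec _ _ _ (fun _ _ a => a.+1)) => //; apply/computable_succ/computable_var.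
Qed.

Lemma computable_pred f : computable f -> computable (fun x => (f x).-1).
Proof.
move=> cf; apply: (@eq_computable _ (fun x => nrec (f x) 0 (fun i _ => i))).
  by move=> x; case: (f x).
apply: (@computable_rec _ _ (fun=> 0) (fun _ i _ => i)) => //; first exact: computable_const.
exact/(@computable_weak s.+1)/computable_var.
Qed.

End Arithmetic.

Section Arithmetic.
Variable s : nat.
Implicit Types (f g b : ctx s -> nat) (F : ctx s -> nat -> nat).

Lemma computable_sub f g : computable f -> computable g -> computable (fun x => f x - g x).
Proof.
move=> cf cg; apply: (@eq_computable _ (fun x => nrec (g x) (f x) (fun _ a => a.-1))).
  by move=> x; elim: (g x) => [|n IH] /=; rewrite ?subn0 // IH subnS.
by apply: (@computable_rec _ _ _ (fun _ _ a => a.-1)) => //; apply/computable_pred/computable_var.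
Qed.

Lemma computable_sum b F : computable b -> computable (fun y : ctx s.+1 => F y.1 y.2) ->
  computable (fun x => \sum_(0 <= i < b x) F x i).
Proof.
move=> cb cF; apply: (@eq_computable _ (fun x => nrec (b x) 0 (fun i a => F x i + a))).
  by move=> x; elim: (b x) => [|n IH] /=; rewrite ?big_nil // big_nat_recr //= IH addnC.
apply: (@computable_rec _ _ (fun=> 0) (fun x i a => F x i + a)) => //; first exact: computable_const.
apply: (@computable_add s.+2 (fun y => F y.1.1 y.1.2) (fun y => y.2)); last exact: computable_var.
by apply: (@computable_weak s.+1 (fun y => F y.1 y.2)).
Qed.

Lemma computable_mul f g : computable f -> computable g -> computable (fun x => f x * g x).
Proof.
move=> cf cg; apply: (@eq_computable _ (fun x => \sum_(0 <= i < f x) g x)).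
  by move=> x; rewrite sum_nat_const_nat subn0.
by apply: (@computable_sum _ (fun x _ => g x)) => //; apply: computable_weak.
Qed.

End Arithmetic.

Section Arithmetic.
Variable s : nat.
Implicit Types (f g b : ctx s -> nat) (F : ctx s -> nat -> nat).

Lemma computable_prod b F : computable b -> computable (fun y : ctx s.+1 => F y.1 y.2) ->
  computable (fun x => \prod_(0 <= i < b x) F x i).
Proof.
move=> cb cF; apply: (@eq_computable _ (fun x => nrec (b x) 1 (fun i a => F x i * a))).
  by move=> x; elim: (b x) => [|n IH] /=; rewrite ?big_nil // big_nat_recr //= IH mulnC.
apply: (@computable_rec _ _ (fun=> 1) (fun x i a => F x i * a)) => //; first exact: computable_const.
apply: (@computable_mul s.+2 (fun y => F y.1.1 y.1.2) (fun y => y.2)); last exact: computable_var.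
by apply: (@computable_weak s.+1 (fun y => F y.1 y.2)).
Qed.

Lemma computable_exp f g : computable f -> computable g -> computable (fun x => f x ^ g x).
Proof.
move=> cf cg; apply: (@eq_computable _ (fun x => \prod_(0 <= i < g x) f x)).
  by move=> x; rewrite prod_nat_const_nat subn0.
by apply: (@computable_prod _ (fun x _ => f x)) => //; apply: computable_weak.
Qed.

Lemma computable_leq f g : computable f -> computable g -> computable (fun x => (f x <= g x) : nat).
Proof.
move=> cf cg; apply: (@eq_computable _ (fun x => 1 - (f x - g x))).
  by move=> x; case: leqP => h; lia.
by apply: computable_sub (computable_sub _ _) => //; apply: computable_const.
Qed.

Lemma computable_eqn f g : computable f -> computable g -> computable (fun x => (f x == g x) : nat).
Proof.
move=> cf cg; apply: (@eq_computable _ (fun x => (f x <= g x) * (g x <= f x))).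
  by move=> x; rewrite eqn_leq mulnb.
by apply: computable_mul; apply: computable_leq.
Qed.

Lemma computable_iter b g (h : ctx s -> nat -> nat) :
  computable b -> computable g -> computable (fun y : ctx s.+1 => h y.1 y.2) ->
  computable (fun x => iter (b x) (h x) (g x)).
Proof.
move=> cb cg ch; apply: (@eq_computable _ (fun x => nrec (b x) (g x) (fun _ a => h x a))).
  by move=> x; elim: (b x) => //= n ->.
apply: (@computable_rec _ _ _ (fun x _ a => h x a)) => //.
exact: computable_drop ch.
Qed.

Lemma computable_seq_sum (T : Type) (l : seq T) (H : T -> ctx s -> nat) :
  (forall u, computable (H u)) -> computable (fun x => \sum_(u <- l) H u x).
Proof.
move=> cH; elim: l => [|u l IH].
  apply: (@eq_computable _ (fun=> 0)); last exact: computable_const.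
  by move=> x; rewrite big_nil.
apply: (@eq_computable _ (fun x => H u x + \sum_(v <- l) H v x)).
  by move=> x; rewrite big_cons.
exact: computable_add.
Qed.

End Arithmetic.

(** A hook, redefined once division, remainder and factorial are available. *)
Ltac computable_ext := idtac.

Ltac computable :=
  try assumption;
  lazymatch goal with
  | |- computable (fun x => addn (@?f x) (@?g x)) =>
      apply: (@computable_add _ f g); computable
  | |- computable (fun x => subn (@?f x) (@?g x)) =>
      apply: (@computable_sub _ f g); computable
  | |- computable (fun x => muln (@?f x) (@?g x)) =>
      apply: (@computable_mul _ f g); computable
  | |- computable (fun x => expn (@?f x) (@?g x)) =>
      apply: (@computable_exp _ f g); computable
  | |- computable (fun x => nat_of_bool (leq (@?f x) (@?g x))) =>
      apply: (@computable_leq _ f g); computable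
  | |- computable (fun x => nat_of_bool (@?f x == @?g x)) =>
      apply: (@computable_eqn _ f g); computable
  | |- computable (fun x => \sum_(0 <= i < @?b x) (@?F x i)) =>
      apply: (@computable_sum _ b F); computable
  | |- computable (fun x => \prod_(0 <= i < @?b x) (@?F x i)) =>
      apply: (@computable_prod _ b F); computable
  | |- computable (fun x => iter (@?b x) (@?h x) (@?g x)) =>
      apply: (@computable_iter _ b g h); computable
  | |- computable (fun x => bit_code (onth (word _) (@?f x))) =>
      apply: (@computable_input _ f); computable
  | |- computable (fun x => S (@?f x)) => apply: (@computable_succ _ f); computable
  | |- computable (fun _ => ?n) => exact: computable_const
  | |- computable (fun x => x.2) => exact: computable_var
  | |- computable snd => exact: computable_var
  | |- computable (fun x => x.1.2) => exact: computable_var1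
  | |- computable (fun x => x.1.1.2) => exact: computable_var2
  | |- computable (fun x => ?f x.1) => apply: (@computable_weak _ f); computable
  | |- computable (fun x => ?f x.1.1) => apply: (@computable_weak2 _ f); computable
  | _ => computable_ext
  end.

(** Bounded search by counting: quotients, lengths and logarithms are obtained as the number of [i]
    below them. *)
Lemma sum_ltn m n : m <= n -> \sum_(0 <= i < n) (i < m) = m.
Proof.
elim: n => [|n IH]; first by rewrite leqn0 big_nil => /eqP.
rewrite big_nat_recr //= leq_eqVlt => /predU1P[->|]; last first.
  by rewrite ltnS => le_m; rewrite IH // ltnNge le_m addn0.
rewrite ltnSn addn1; congr S; rewrite -[RHS]muln1 -[X in X * _]subn0 -sum_nat_const_nat.
by apply: eq_big_nat => i /andP[_ lt_i]; rewrite ltnW.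
Qed.

Section Arithmetic.
Variable s : nat.
Implicit Types (f g : ctx s -> nat).

Lemma computable_div f g : computable f -> computable g -> computable (fun x => f x %/ g x).
Proof.
move=> cf cg.
(* The first factor accounts for the value 0 of a division by 0. *)
apply: (@eq_computable _ (fun x => (0 < g x) * \sum_(0 <= i < f x) (i.+1 * g x <= f x))).
  move=> x; case: posnP => [->|g0]; rewrite ?divn0 // mul1n.
  have -> : \sum_(0 <= i < f x) (i.+1 * g x <= f x) = \sum_(0 <= i < f x) (i < f x %/ g x).
    by apply: eq_bigr => i _; rewrite -leq_divRL.
  by rewrite sum_ltn // leq_div.
computable.
Qed.

Lemma computable_mod f g : computable f -> computable g -> computable (fun x => f x %% g x).
Proof.
move=> cf cg; apply: (@eq_computable _ (fun x => f x - (f x %/ g x) * g x)).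
  by move=> x; rewrite {1}(divn_eq (f x) (g x)) addKn.
by have := computable_div cf cg => ?; computable.
Qed.

Lemma computable_fact f : computable f -> computable (fun x => (f x)`!).
Proof.
move=> cf; apply: (@eq_computable _ (fun x => \prod_(0 <= i < f x) i.+1)); last by computable.
by move=> x; rewrite fact_prod big_add1.
Qed.

End Arithmetic.

Ltac computable_ext ::=
  lazymatch goal with
  | |- computable (fun x => divn (@?f x) (@?g x)) =>
      apply: (@computable_div _ f g); computable
  | |- computable (fun x => modn (@?f x) (@?g x)) =>
      apply: (@computable_mod _ f g); computable
  | |- computable (fun x => factorial (@?f x)) =>
      apply: (@computable_fact _ f); computable
  | _ => match goal with H : computable _ |- _ =>
           first [exact (computable_weak H) | exact (computable_weak2 H)] end
  end.

(** Since a < 2(a + b) + 1, the integer square root of the code is a + b, whence injectivity. The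
    code bounds both components, so the projections are bounded sums with one nonzero term at
    most. *)
Definition pair_num a b := (a + b) ^ 2 + a.

Lemma pair_num_inj a b c d : pair_num a b = pair_num c d -> a = c /\ b = d.
Proof.
rewrite /pair_num !expnS !expn0 !muln1 => E.
have lt x y u v : (x + y) * (x + y) + x = (u + v) * (u + v) + u -> x + y <= u + v.
  by move=> h; rewrite leqNgt; apply/negP => l; have := leq_mul l l; nia.
have e : a + b = c + d by apply/eqP; rewrite eqn_leq !lt.
by rewrite e in E; lia.
Qed.

Lemma eq_pair_num a b c d : (pair_num a b == pair_num c d) = (a == c) && (b == d).
Proof.
by apply/eqP/andP => [/pair_num_inj[-> ->]|[/eqP-> /eqP->]].
Qed.

Lemma sum_pick n k (F : nat -> nat) :
  k < n -> \sum_(0 <= i < n) (i == k) * F i = F k.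
Proof.
move=> lt_k; rewrite (bigD1_seq k) ?mem_index_iota ?iota_uniq //= eqxx mul1n.
by rewrite big1 ?addn0 // => i /negbTE ->.
Qed.

Definition fst_num n := \sum_(0 <= a < n.+1) \sum_(0 <= b < n.+1) (pair_num a b == n) * a.
Definition snd_num n := \sum_(0 <= a < n.+1) \sum_(0 <= b < n.+1) (pair_num a b == n) * b.

Lemma pair_num_ge a b : a <= pair_num a b /\ b <= pair_num a b.
Proof. by rewrite /pair_num !expnS expn0; nia. Qed.

Lemma sum_unpair a b (F : nat -> nat -> nat) :
  \sum_(0 <= c < (pair_num a b).+1) \sum_(0 <= d < (pair_num a b).+1)
     (pair_num c d == pair_num a b) * F c d = F a b.
Proof.
have [le_a le_b] := pair_num_ge a b.
rewrite -[RHS](@sum_pick (pair_num a b).+1 a (fun c => F c b)) //.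
apply: eq_bigr => c _.
rewrite -(@sum_pick (pair_num a b).+1 b (fun d => (c == a) * F c d)) //.
by apply: eq_bigr => d _; rewrite eq_pair_num mulnA mulnb andbC.
Qed.

Lemma pair_numK1 a b : fst_num (pair_num a b) = a.
Proof. exact: (sum_unpair a b (fun a _ => a)). Qed.

Lemma pair_numK2 a b : snd_num (pair_num a b) = b.
Proof. exact: (sum_unpair a b (fun _ b => b)). Qed.

Lemma computable_pair s (f g : ctx s -> nat) :
  computable f -> computable g -> computable (fun x => pair_num (f x) (g x)).
Proof. by move=> cf cg; rewrite /pair_num; computable. Qed.

Lemma computable_fst s (f : ctx s -> nat) :
  computable f -> computable (fun x => fst_num (f x)).
Proof. by move=> cf; rewrite /fst_num /pair_num; computable. Qed.

Lemma computable_snd s (f : ctx s -> nat) :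
  computable f -> computable (fun x => snd_num (f x)).
Proof. by move=> cf; rewrite /snd_num /pair_num; computable. Qed.

(** * Arithmetization of Turing machines *)

Section Stutter.
Variables (T : Type) (f : T -> option T).

(** A halted configuration is repeated, so that a run is a plain iteration of a total function. *)
Definition stutter c := odflt c (f c).

Lemma reach_stutter n c c' : reach f n c c' -> iter n stutter c = c'.
Proof.
elim: n c' => [|n IH] c'; first by case.
rewrite /reach !iterS; case E: (iter n _ _) => [c1|] //= fc1.
by rewrite (IH _ E) /stutter fc1.
Qed.

Lemma stutter_reach n c : exists2 m, m <= n & reach f m c (iter n stutter c).
Proof.
elim: n => [|n [m le_m r]]; first by exists 0.
rewrite iterS /stutter; case E: (f _) => [c'|] /=; last by exists m; rewrite // leqW.
by exists m.+1 => //; rewrite -addn1; apply: reachD r _; rewrite /reach /= E.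
Qed.

Lemma stutter_halt m n c : f (iter m stutter c) = None -> m <= n ->
  iter n stutter c = iter m stutter c.
Proof.
move=> h /subnK <-; elim: (n - m) => //= k ->.
by rewrite /stutter h.
Qed.

End Stutter.

Lemma evals_stutter (M : machine) x y : evals M x y <->
  exists n, let c := iter n (stutter (@step M)) (init M x) in
            step c = None /\ output c = y.
Proof.
split=> [[n [c [r h o]]]|[n [h o]]].
  by exists n; rewrite (reach_stutter r).
by have [m _ r] := stutter_reach (@step M) n (init M x); exists m; eexists; split; first exact: r.
Qed.

Section Simulation.
Variable M : machine.
Local Notation base := (3 + #|aux M|).

Definition symbol_num (s : symbol (aux M)) : nat :=
  match s with
  | None => 0
  | Some (inl b) => b.+1
  | Some (inr g) => 3 + enum_rank g
  end.

Lemma symbol_num_inj : injective symbol_num.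
Proof.
move=> [[b|g]|] [[b'|g']|] //=; rewrite ?add3n.
- by case: b b' => [] [].
- by case: b => [].
- by case: b' => [].
- by move=> [/val_inj/enum_rank_inj ->].
Qed.

Lemma symbol_num_lt s : symbol_num s < base.
Proof. by case: s => [[[]|g]|] //=; rewrite ?ltn_add2l. Qed.

(* A half tape is a number in base [base], with the blank as digit 0, so that *)
(* trailing blanks do not matter.                                             *)
Definition tape_num (l : seq (symbol (aux M))) : nat :=
  foldr (fun s n => symbol_num s + base * n) 0 l.

Lemma tape_num_head l : tape_num l %% base = symbol_num (head None l).
Proof.
by case: l => [|s l] //=; rewrite addnC mulnC modnMDl modn_small // symbol_num_lt.
Qed.

Lemma tape_num_behead l : tape_num l %/ base = tape_num (behead l).
Proof.
case: l => [|s l] //=; rewrite addnC mulnC divnMDl //.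
by rewrite divn_small ?addn0 // symbol_num_lt.
Qed.

Lemma tape_num_digit l j : tape_num l %/ base ^ j %% base = symbol_num (nth None l j).
Proof.
elim: j l => [|j IH] l; first by rewrite expn0 divn1 tape_num_head nth0.
rewrite expnS -[base * _]/(base * _) divnMA tape_num_behead IH.
by case: l => [|s l] //=; rewrite nth_nil.
Qed.

Lemma tape_num_sum l t : size l <= t ->
  tape_num l = \sum_(0 <= i < t) symbol_num (nth None l i) * base ^ i.
Proof.
elim: l t => [|s l IH] [|t] //= le_t.
- by rewrite big_nil.
- by rewrite big1_seq // => i _; rewrite nth_nil.
rewrite big_nat_recl //= expn0 muln1; congr addn.
rewrite (IH t) // big_distrr /=; apply: eq_bigr => i _.
by rewrite expnS mulnCA.
Qed.

Definition config_num (c : config M) : nat :=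
  pair_num (pair_num (enum_rank c.1) (symbol_num (tape_head c.2)))
           (pair_num (tape_num (tape_left c.2)) (tape_num (tape_right c.2))).

Definition move_num q s (d : direction) l r : nat :=
  match d with
  | Left => pair_num (pair_num q (l %% base)) (pair_num (l %/ base) (s + base * r))
  | Stay => pair_num (pair_num q s) (pair_num l r)
  | Right => pair_num (pair_num q (r %% base)) (pair_num (s + base * l) (r %/ base))
  end.

Lemma move_numE q s d t :
  move_num (enum_rank q) (symbol_num s) d
    (tape_num (tape_left t)) (tape_num (tape_right t)) = config_num (q, write_move s d t).
Proof.
by case: t d => l h r [] //=; rewrite tape_num_head tape_num_behead.
Qed.

(** Case distinction on the state and the scanned symbol, written as a finite sum in which only the
    matching entry of the table contributes. *)
Definition table_num c (F : state M * symbol (aux M) -> nat) :=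
  \sum_(u <- enum {: state M * symbol (aux M)})
    (fst_num c == pair_num (enum_rank u.1) (symbol_num u.2)) * F u.

Lemma table_numE c F : table_num (config_num c) F = F (c.1, tape_head c.2).
Proof.
rewrite /table_num (bigD1_seq (c.1, tape_head c.2)) ?mem_enum ?enum_uniq //=.
rewrite pair_numK1 eqxx mul1n big1 ?addn0 // => -[q s] ne.
rewrite eq_pair_num /=; case: eqP => //= /val_inj/enum_rank_inj e1.
case: eqP => //= /symbol_num_inj e2.
by rewrite e1 e2 eqxx in ne.
Qed.

Definition step_num c := table_num c (fun u =>
  if delta u.1 u.2 is Some (q, s, d)
  then move_num (enum_rank q) (symbol_num s) d (fst_num (snd_num c)) (snd_num (snd_num c))
  else c).

Lemma step_numE c : step_num (config_num c) = config_num (stutter (@step M) c).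
Proof.
rewrite /step_num table_numE /= /stutter /step; case: delta => [[[q s] d]|] //=.
by rewrite pair_numK2 pair_numK1 pair_numK2 move_numE.
Qed.

Definition halt_num c := table_num c (fun u => ~~ isSome (delta u.1 u.2)).

Lemma halt_numE c : halt_num (config_num c) = ~~ isSome (step c).
Proof. by rewrite /halt_num table_numE /step; case: delta => [[[q s] d]|]. Qed.

Definition start_num n :=
  pair_num (pair_num (enum_rank (start M)) (n %% base)) (pair_num 0 (n %/ base)).

Definition input x : seq (symbol (aux M)) := [seq Some (inl b) | b <- x].

Definition run_num t n := iter t step_num (start_num n).

Lemma run_numE t x : run_num t (tape_num (input x)) =
  config_num (iter t (stutter (@step M)) (init M x)).
Proof.
rewrite /run_num; elim: t => [|t IH]; last by rewrite !iterS IH step_numE.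
by rewrite /= /start_num tape_num_head tape_num_behead.
Qed.

Definition output_num c := snd_num (fst_num c) + base * snd_num (snd_num c).

Lemma output_numE c : output_num (config_num c) = tape_num (tape_head c.2 :: tape_right c.2).
Proof. by rewrite /output_num /config_num pair_numK1 !pair_numK2. Qed.

Definition digit n j := n %/ base ^ j %% base.

(** Digits 1 and 2 code the bits, and the product tells whether the first i + 1 symbols are bits.
    The bound [n] suffices because the digits of bits are nonzero. *)
Definition length_num n :=
  \sum_(0 <= i < n) \prod_(0 <= j < i.+1) ((1 <= digit n j) * (digit n j <= 2)).

Definition is_bit (s : symbol (aux M)) := (0 < symbol_num s) * (symbol_num s <= 2).

Lemma is_bitE s : is_bit s = (if s is Some (inl _) then true else false) :> nat.
Proof. by case: s => [[[]|g]|]; rewrite /is_bit /= ?add3n. Qed.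

Lemma prod_is_bit l i : \prod_(0 <= j < i.+1) is_bit (nth None l j) = (i < size (leading_bits l)) :> nat.
Proof.
elim: l i => [|s l IH] i.
  by rewrite big_nat_recl // nth_nil is_bitE.
rewrite big_nat_recl //= is_bitE; case: s => [[b|g]|] //=.
case: i => [|i]; first by rewrite big_nil.
by rewrite IH mul1n.
Qed.

Lemma length_numE l : length_num (tape_num l) = size (leading_bits l).
Proof.
have le : size (leading_bits l) <= tape_num l.
  elim: l => [|[[b|g]|] l IH] //=; rewrite addSn ltnS.
  by apply: leq_trans IH _; rewrite -{1}[tape_num l]mul1n; nia.
rewrite -[RHS](sum_ltn le); apply: eq_bigr => i _; rewrite -prod_is_bit.
by apply: eq_bigr => j _; rewrite /digit tape_num_digit.
Qed.

Lemma digit_leading_bits l i : i < size (leading_bits l) ->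
  (digit (tape_num l) i == 2) = nth false (leading_bits l) i.
Proof.
rewrite /digit tape_num_digit; elim: l i => [|[[b|g]|] l IH] //= [|i] //=; last exact: IH.
by case: b.
Qed.

Section Computable.
Variable s : nat.
Implicit Types f g : ctx s -> nat.

Lemma computable_step f : computable f -> computable (fun x => step_num (f x)).
Proof.
move=> cf; apply: computable_seq_sum => u; apply: computable_mul.
  by have := computable_fst cf => ?; computable.
case: delta => [[[q s'] d]|] //.
have c2 := computable_snd cf; have c21 := computable_fst c2; have c22 := computable_snd c2.
by case: d; do ?apply: computable_pair; computable.
Qed.

Lemma computable_halt f : computable f -> computable (fun x => halt_num (f x)).
Proof.
move=> cf; apply: computable_seq_sum => u.
by have := computable_fst cf => ?; computable.
Qed.

End Computable.

Section Computable.
Variable s : nat.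
Implicit Types f g : ctx s -> nat.

Lemma computable_run f g :
  computable f -> computable g -> computable (fun x => run_num (f x) (g x)).
Proof.
move=> cf cg; apply: (@computable_iter _ f (fun x => start_num (g x)) (fun _ => step_num)) => //.
  by do ?apply: computable_pair; computable.
refine (@computable_step s.+1 (fun x : ctx s.+1 => x.2) _); exact: computable_var.
Qed.

Lemma computable_output f : computable f -> computable (fun x => output_num (f x)).
Proof.
move=> cf; rewrite /output_num.
have c1 := computable_snd (computable_fst cf); have c2 := computable_snd (computable_snd cf).
by computable.
Qed.

Lemma computable_length f : computable f -> computable (fun x => length_num (f x)).
Proof. by move=> cf; rewrite /length_num /digit; computable. Qed.

End Computable.

End Simulation.

(** * Binary strings and Kraft's inequality *)

Lemma size_bin n : size (bin n) = trunc_log 2 n.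
Proof. by rewrite size_rev size_map size_iota. Qed.

Lemma nth_bin n i : i < trunc_log 2 n ->
  nth false (bin n) i = odd (n %/ 2 ^ (trunc_log 2 n - i.+1)).
Proof.
move=> lt_i; rewrite nth_rev size_map size_iota // (nth_map 0) ?size_iota ?nth_iota ?add0n //; lia.
Qed.

Definition unbin (x : seq bool) : nat := foldl (fun n (b : bool) => b + n.*2) 1 x.

Lemma unbin_rcons x b : unbin (rcons x b) = b + (unbin x).*2.
Proof. by rewrite /unbin foldl_rcons. Qed.

Lemma unbin_gt0 x : 0 < unbin x.
Proof. by elim/last_ind: x => // x b IH; rewrite unbin_rcons; lia. Qed.

Lemma unbin_lt x : unbin x < 2 ^ (size x).+1.
Proof.
elim/last_ind: x => // x b IH; rewrite unbin_rcons size_rcons expnS; move: IH; case: b; lia.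
Qed.

Lemma bin_double n (b : bool) : 0 < n -> bin (b + n.*2) = rcons (bin n) b.
Proof.
move=> n0; rewrite /bin trunc_log2S ?half_bit_double; last by case: b; lia.
rewrite /= rev_cons expn0 divn1 oddD odd_double addbF oddb; congr rcons.
rewrite -[1]addn0 iotaDl -map_comp; congr rev; apply: eq_map => i /=.
by rewrite expnS divnMA divn2 half_bit_double.
Qed.

Lemma unbinK x : bin (unbin x) = x.
Proof.
elim/last_ind: x => [|x b IH]; first by rewrite /bin trunc_log1.
by rewrite unbin_rcons bin_double ?unbin_gt0 // IH.
Qed.

Lemma binK n : 0 < n -> unbin (bin n) = n.
Proof.
elim/ltn_ind: n => n IH n0; case: (ltngtP n 1) n0 => // [lt1 _|-> _]; last by rewrite /bin trunc_log1.
have h0 : 0 < n./2 by lia.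
by rewrite -{1}[n]odd_double_half bin_double // unbin_rcons IH ?odd_double_half //; lia.
Qed.

Lemma kraft_nil N (s : seq (seq bool)) : uniq s ->
  {in s &, forall x y, prefix x y -> x = y} -> [::] \in s ->
  \sum_(x <- s) 2 ^ (N - size x) <= 2 ^ N.
Proof.
move=> us pf s0.
have : size s <= 1.
  apply: (@uniq_leq_size _ s [:: [::]]) => // y ys.
  by rewrite inE; apply/eqP/esym/pf => //; rewrite prefix0s.
case: s {us pf} s0 => [|x [|? ?]] // _ _.
by rewrite big_seq1 leq_exp2l // leq_subr.
Qed.

(** Induction on the maximal length, with both sides scaled by 2^N to stay in the integers. The
    tails of the words with a given first letter are again prefix-free, and each of the two families
    takes at most half of the total. *)
Lemma kraft N (s : seq (seq bool)) : uniq s ->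
  {in s &, forall x y, prefix x y -> x = y} -> {in s, forall x, size x <= N} ->
  \sum_(x <- s) 2 ^ (N - size x) <= 2 ^ N.
Proof.
elim: N s => [|N IH] s us pf le_s; have [s0|s0] := boolP ([::] \in s).
- by rewrite kraft_nil.
- rewrite big1_seq // => x /andP[_ xs].
  by have := le_s _ xs; rewrite leqn0 => /nilP x0; rewrite x0 (negbTE s0) in xs.
- by rewrite kraft_nil.
pose tl b := [seq behead x | x <- s & head false x == b].
have tlP b y : y \in tl b -> b :: y \in s.
  case/mapP => x; rewrite mem_filter => /andP[/eqP <- xs] ->.
  by case: x xs => // xs; rewrite xs in s0.
have tl_le b : \sum_(y <- tl b) 2 ^ (N - size y) <= 2 ^ N.
  apply: IH => [|x y /tlP xs /tlP ys pxy|y /tlP/le_s //] /=.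
  - rewrite map_inj_in_uniq ?filter_uniq // => x y.
    rewrite !mem_filter => /andP[/eqP hx xs] /andP[/eqP hy ys].
    case: x hx xs => [|a x] hx xs; first by rewrite xs in s0.
    case: y hy ys => [|c y] hy ys; first by rewrite ys in s0.
    by move: hx hy => /= -> -> ->.
  - by have := pf _ _ xs ys; rewrite prefix_cons eqxx pxy => /(_ isT)[].
have -> : \sum_(x <- s) 2 ^ (N.+1 - size x) =
    \sum_(y <- tl true) 2 ^ (N - size y) + \sum_(y <- tl false) 2 ^ (N - size y).
  rewrite !big_map !big_filter (bigID (fun x => head false x == true)) /=.
  rewrite [X in _ + X](eq_bigl (fun x => head false x == false)); last by move=> x; case: head.
  by congr addn; rewrite big_seq_cond [RHS]big_seq_cond; apply: eq_bigr => -[|a x] /andP[xs _];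
     rewrite ?subSS //; rewrite xs in s0.
by rewrite expnS mul2n -addnn leq_add.
Qed.

(** * The diagonal machine *)

Definition binary_value (z : seq bool) :=
  \sum_(0 <= i < size z) nth false z i * 2 ^ (size z - i.+1).

Section Halting.
Variable M : machine.

Definition config_at x t := iter t (stutter (@step M)) (init M x).

Definition halts_by x t := ~~ isSome (step (config_at x t)).

Lemma halts_byP x t : reflect (step (config_at x t) = None) (halts_by x t).
Proof. by rewrite /halts_by; case: step => [c|] /=; constructor. Qed.

Lemma halts_by_mono x t u : t <= u -> halts_by x t -> halts_by x u.
Proof.
by move=> le_tu /halts_byP h; apply/halts_byP; rewrite /config_at (stutter_halt h).
Qed.

Lemma evals_at x t : halts_by x t -> evals M x (output (config_at x t)).
Proof. by move=> /halts_byP h; apply/evals_stutter; exists t. Qed.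

Lemma evals_halts_by x y : evals M x y ->
  exists2 t, halts_by x t & output (config_at x t) = y.
Proof. by move=> /evals_stutter[t [h o]]; exists t => //; apply/halts_byP. Qed.

Lemma symbol_num_input x i : symbol_num (nth None (input M x) i) = bit_code (onth x i).
Proof. by rewrite /input; elim: x i => [|b x IH] [|i] //=; rewrite ?nth_nil. Qed.

Lemma input_num_sum x t : size x <= t ->
  tape_num (input M x) = \sum_(0 <= i < t) bit_code (onth x i) * (3 + #|aux M|) ^ i.
Proof.
move=> le_t; rewrite (@tape_num_sum _ _ t) ?size_map //.
by apply: eq_bigr => i _; rewrite symbol_num_input.
Qed.

Definition log2_num n := \sum_(0 <= i < n) (2 ^ i.+1 <= n).

Lemma log2_numE n : 0 < n -> log2_num n = trunc_log 2 n.
Proof.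
move=> n0; have le_n : trunc_log 2 n <= n.
  by apply: leq_trans (trunc_logP (isT : 1 < 2) n0); apply/ltnW/ltn_expl.
rewrite -[RHS](sum_ltn le_n); apply: eq_bigr => i _.
have /andP[lo hi] := @trunc_log_bounds 2 n isT n0.
congr nat_of_bool; apply/idP/idP => [|lt_i]; first exact: trunc_log_max.
by apply: leq_trans lo; rewrite leq_exp2l.
Qed.

Definition bin_input_num n :=
  \sum_(0 <= i < log2_num n)
    (n %/ 2 ^ (log2_num n - i.+1) %% 2).+1 * (3 + #|aux M|) ^ i.

Lemma bin_input_numE n : 0 < n -> bin_input_num n = tape_num (input M (bin n)).
Proof.
move=> n0; rewrite (@input_num_sum _ (size (bin n))) // size_bin /bin_input_num log2_numE //.
apply: eq_big_nat => i /andP[_ lt_i]; congr (_ * _).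
have := onthTE (bin n) i; have := odflt_onth false (bin n) i.
by rewrite size_bin lt_i nth_bin //; case: onth => //= b ->; rewrite modn2.
Qed.

Definition bin_config_num n t := run_num M t (bin_input_num n).

Lemma bin_config_numE n t : 0 < n -> bin_config_num n t = config_num (config_at (bin n) t).
Proof. by move=> n0; rewrite /bin_config_num bin_input_numE // run_numE. Qed.

Lemma computable_bin_config s (f g : ctx s -> nat) :
  computable f -> computable g -> computable (fun x => bin_config_num (f x) (g x)).
Proof.
move=> cf cg; apply: computable_run => //; rewrite /bin_input_num.
have cl : computable (fun x => log2_num (f x)) by rewrite /log2_num; computable.
by computable.
Qed.

End Halting.

Arguments bin_config_num : clear implicits.

Lemma output_size_numE (M : machine) (c : config M) :
  length_num M (output_num M (config_num c)) = size (output c).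
Proof. by rewrite output_numE length_numE. Qed.

Section Diagonal.
Variables (U W : machine) (k : nat).

Definition halted_sum t := \sum_(0 <= i < t) halts_by W (bin i.+1) t * (t`! %/ i.+1).

(** Strictly greater than the length of every output found by stage [t], each of them being part of
    the sum with one added. *)
Definition diagonal_length t := \sum_(0 <= i < t)
  halts_by W (bin i.+1) t * (size (output (config_at W (bin i.+1) t))).+1.

(* This says k + 0.z < \sum_n 1/n, where n ranges over the n <= t such that W *)
(* halts on bin(n) within t steps, multiplied by 2 ^ |z| * t!.                *)
Definition exceeds z t :=
  (k * 2 ^ size z + binary_value z) * t`! < 2 ^ size z * halted_sum t.

(** The number [x.2] bounds both the steps and the input bits read. The first factor of [stage_num]
    checks that the whole input has been read. *)
Definition input_config_num (x : ctx 1) :=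
  run_num U x.2 (\sum_(0 <= i < x.2) bit_code (onth (word x) i) * (3 + #|aux U|) ^ i).

Definition halted_sum_num t :=
  \sum_(0 <= i < t) halt_num W (bin_config_num W i.+1 t) * (t`! %/ i.+1).

Definition binary_value_num n := \sum_(0 <= i < length_num U n)
  (digit U n i == 2) * 2 ^ (length_num U n - i.+1).

Definition stage_num (x : ctx 1) :=
  let n := output_num U (input_config_num x) in
  (bit_code (onth (word x) x.2) == 0) * (halt_num U (input_config_num x) *
  ((k * 2 ^ length_num U n + binary_value_num n) * x.2`! < 2 ^ length_num U n * halted_sum_num x.2)).

Definition length_at (x : ctx 1) := \sum_(0 <= i < x.2)
  halt_num W (bin_config_num W i.+1 x.2) *
  (length_num W (output_num W (bin_config_num W i.+1 x.2))).+1.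

Lemma computable_length_at : computable length_at.
Proof.
have cW : computable (fun x : ctx 2 => bin_config_num W x.2.+1 x.1.2).
  by apply: computable_bin_config; computable.
have cH := computable_halt W cW; have cL := computable_length W (computable_output W cW).
by rewrite /length_at; computable.
Qed.

Lemma computable_stage : computable stage_num.
Proof.
have cU : computable input_config_num by apply: computable_run; computable.
have cN := computable_output U cU; have cL := computable_length U cN.
have cW : computable (fun x : ctx 2 => bin_config_num W x.2.+1 x.1.2).
  by apply: computable_bin_config; computable.
have cH := computable_halt W cW; have cHU := computable_halt U cU.
have cD : computable (fun x : ctx 2 => digit U (output_num U (input_config_num x.1)) x.2).
  by rewrite /digit; computable.
have cV : computable (fun x => binary_value_num (output_num U (input_config_num x))).
  by rewrite /binary_value_num; computable.
have cS : computable (fun x : ctx 1 => halted_sum_num x.2).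
  by rewrite /halted_sum_num; computable.
by rewrite /stage_num; computable.
Qed.

Lemma halted_sum_numE t : halted_sum_num t = halted_sum t.
Proof. by apply: eq_bigr => i _; rewrite bin_config_numE // halt_numE. Qed.

Lemma length_atE w t : length_at (w, t) = diagonal_length t.
Proof.
apply: eq_bigr => i _; rewrite bin_config_numE // halt_numE.
by rewrite output_size_numE.
Qed.

Lemma stage_numE w t :
  stage_num (w, t) <> 0 <->
  [/\ size w <= t, halts_by U w t & exceeds (output (config_at U w t)) t].
Proof.
rewrite /stage_num /=.
have -> : (bit_code (onth w t) == 0) = (size w <= t).
  by rewrite -onthNE; case: onth.
case: (leqP (size w) t) => [le_t|_]; last by rewrite -[nat_of_bool false]/0 mul0n; split=> // -[].
rewrite -[nat_of_bool true]/1 mul1n.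
have -> : input_config_num (w, t) = config_num (config_at U w t).
  by rewrite /input_config_num /= -input_num_sum // run_numE.
rewrite halt_numE -/(halts_by U w t); case: (halts_by U w t); last first.
  by rewrite -[nat_of_bool false]/0 mul0n; split=> // -[].
rewrite -[nat_of_bool true]/1 mul1n halted_sum_numE output_size_numE.
have -> : binary_value_num (output_num U (config_num (config_at U w t))) =
    binary_value (output (config_at U w t)).
  rewrite /binary_value_num /binary_value output_size_numE.
  apply: eq_big_nat => i /andP[_ lt_i].
  by rewrite output_numE digit_leading_bits.
rewrite -/(exceeds _ t); case: exceeds; split=> //; by case.
Qed.

(** [D] searches the least stage where [stage_num] is nonzero. Late stages qualify if the partial
    sums exceed k + 0.z, the output of [U] being the same at all stages after it halts. A qualifying
    stage shows that [U] halts on [w], so [D] inherits prefix-freeness from [U]. *)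
Lemma diagonal_machine : exists D, forall w,
  (forall z, evals U w z -> (exists t0, forall t, t0 <= t -> exceeds z t) ->
     exists2 t, exceeds z t & evals D w (nseq (diagonal_length t) true)) /\
  (dom D w -> dom U w).
Proof.
have [D spec] := search_machine computable_stage computable_length_at.
exists D => w; have [run div] := spec w; split.
  move=> z Uz [t0 ex].
  have [u hu ou] := evals_halts_by Uz.
  have out t : halts_by U w t -> output (config_at U w t) = z.
    by move=> /evals_at/evals_inj; apply.
  have E : exists t, stage_num (w, t) != 0.
    exists (maxn (size w) (maxn u t0)); apply/eqP/stage_numE.
    have h : halts_by U w (maxn (size w) (maxn u t0)).
      by apply: halts_by_mono hu; rewrite !leq_max leqnn !orbT.
    by split; rewrite ?out // ?leq_maxl // ex // !leq_max leqnn !orbT.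
  case: (ex_minnP E) => t /eqP Pt min_t.
  have /stage_numE[_ h] := Pt; rewrite out // => ext.
  exists t => //; rewrite -(length_atE w); apply: run => // v lt_v.
  by apply/eqP/negPn/negP => /min_t; rewrite leqNgt lt_v.
move=> dD; apply: contrapT => nU; apply: div dD => t.
apply/eqP/negPn/negP => /eqP/stage_numE[_ /evals_at ev _].
by apply: nU; eexists; exact: ev.
Qed.

End Diagonal.

(** * A machine with short programs for long blocks of ones *)

Definition unary k := rcons (nseq k false) true.

Definition unary_num (x : ctx 1) : nat :=
  (bit_code (onth (word x) x.2) == 2) * (bit_code (onth (word x) x.2.+1) == 0) *
  \prod_(0 <= i < x.2) (bit_code (onth (word x) i) == 1).

Lemma computable_unary : computable unary_num.
Proof. by rewrite /unary_num; computable. Qed.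

Lemma onth_unary k i :
  onth (unary k) i = if i < k then Some false else if i == k then Some true else None.
Proof.
rewrite /unary -cats1 onth_cat onth_nseq size_nseq; case: ltnP => // le_ki.
by case: eqP => [->|ne]; rewrite ?subnn //; case E: (i - k) => [|j] //=; [lia | case: j E].
Qed.

Lemma unary_inj_prefix j k : prefix (unary j) (unary k) -> unary j = unary k.
Proof.
move=> /prefixP[z E]; have := onth_unary k j; rewrite E onth_cat size_rcons size_nseq ltnSn.
by rewrite onth_unary ltnn eqxx -E; case: ltngtP => // ->.
Qed.

Lemma unary_numE w t : unary_num (w, t) <> 0 <-> w = unary t.
Proof.
split=> [|->]; last first.
  have e1 : onth (unary t) t = Some true by rewrite onth_unary ltnn eqxx.
  have e2 : onth (unary t) t.+1 = None by rewrite onth_default // size_rcons size_nseq.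
  rewrite /unary_num [word _]/= [(_, _).2]/= e1 e2 mul1n.
  rewrite big1_seq // => i /andP[_]; rewrite mem_index_iota => /andP[_ lt_i].
  by rewrite onth_unary lt_i.
rewrite /unary_num [word _]/= [(_, _).2]/= => /eqP; rewrite !muln_eq0 !negb_or => /andP[/andP[h1 h2] h3].
have lt_i i : i < t -> onth w i = Some false.
  move=> lt_i; apply/eqP; move: h3; rewrite (bigD1_seq i) ?mem_index_iota ?iota_uniq //=.
  by rewrite muln_eq0 negb_or => /andP[+ _]; case: onth => [[]|].
have size_w : size w <= t.+1.
  by rewrite -onthNE; move: h2; case: onth.
apply/eq_from_onth => i; rewrite onth_unary; case: ltngtP => [/lt_i //|lt_ti|->].
  by rewrite onth_default // (leq_trans size_w).
by move: h1; case: onth => [[]|].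
Qed.

(** A block of 2k ones gets a program of k + 1 bits, so the digits 0.111... are too simple; this
    excludes an integral zeta number. *)
Lemma unary_machine : exists M, self_delimiting M /\
  forall k, evals M (unary k) (nseq (2 * k) true).
Proof.
have [|M spec] := search_machine computable_unary (L := fun x => 2 * x.2).
  by computable.
have dM x : dom M x -> exists k, x = unary k.
  move=> dx; apply: contrapT => nx; apply: (spec x).2 dx => t.
  by apply/eqP/negPn/negP => /eqP/unary_numE E; apply: nx; exists t.
exists M; split=> [x y /dM[j ->] /dM[k ->]|k]; first exact: unary_inj_prefix.
apply: (spec (unary k)).1; first exact/unary_numE.
move=> u lt_u; apply/eqP/negPn/negP => /eqP/unary_numE /(congr1 size).
by rewrite !size_rcons !size_nseq; lia.
Qed.

Lemma binary_value_rcons z b : binary_value (rcons z b) = 2 * binary_value z + b.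
Proof.
rewrite /binary_value size_rcons big_nat_recr //= nth_rcons ltnn eqxx subnn muln1.
congr (_ + _); rewrite big_distrr /=; apply: eq_big_nat => i /andP[_ lt_i].
by rewrite nth_rcons lt_i subSS -(subnSK lt_i) expnS mulnCA.
Qed.

Import Order.TTheory GRing.Theory Num.Theory.
Import numFieldNormedType.Exports.
Local Open Scope classical_set_scope.
Local Open Scope ring_scope.

(** * Zeta numbers *)

Section Zeta.
Variables (R : realType) (M : machine).

Lemma zeta_ge (s : seq nat) : uniq s -> (forall n, n \in s -> (0 < n)%N /\ dom M (bin n)) ->
  ((\sum_(n <- s) n%:R^-1 : R)%:E <= zeta R M)%E.
Proof.
move=> us sM; apply: ereal_sup_ubound; exists [set` s]%classic.
  by split; [exact: finite_seq | move=> n /sM].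
by rewrite -fsbig_seq // sumEFin.
Qed.

Lemma zeta_gt (q : R) : (q%:E < zeta R M)%E -> exists s : seq nat,
  [/\ uniq s, forall n, n \in s -> (0 < n)%N /\ dom M (bin n) & q < \sum_(n <- s) n%:R^-1].
Proof.
move=> /ereal_sup_gt[_ [A [finA sub] <-]].
rewrite fsbig_finite // sumEFin lte_fin => ltq.
exists (finmap.enum_fset (fset_set A)); split=> [|n|] //; first exact: finmap.fset_uniq.
by rewrite in_fset_set // inE; exact: sub.
Qed.

Lemma zeta_ge0 : (0 <= zeta R M)%E.
Proof. by apply: esum_ge0 => n _; rewrite lee_fin invr_ge0. Qed.

(** As n >= 2^|bin(n)|, each finite partial sum is at most the Kraft sum of a prefix-free set.
    Multiplying by 2^N, with [N] the greatest length, reduces this to [kraft]. *)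
Lemma self_delimiting_tuatara : self_delimiting M -> tuatara R M.
Proof.
move=> sdM; apply: ge_ereal_sup => _ [A [finA sub] <-].
rewrite fsbig_finite // sumEFin lee_fin.
have sM n : n \in finmap.enum_fset (fset_set A) -> (0 < n)%N /\ dom M (bin n).
  by rewrite in_fset_set // inE; exact: sub.
set s := finmap.enum_fset (fset_set A) in sM *.
pose N := \max_(n <- s) trunc_log 2 n.
have le_N n : n \in s -> (size (bin n) <= N)%N.
  by move=> ns; rewrite size_bin; apply: leq_bigmax_seq.
have K : (\sum_(n <- s) 2 ^ (N - size (bin n)) <= 2 ^ N)%N.
  have := @kraft N (map bin s); rewrite big_map; apply.
  - rewrite map_inj_in_uniq ?finmap.fset_uniq // => m n /sM[m0 _] /sM[n0 _] e.
    by rewrite -(binK m0) e binK.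
  - by move=> _ _ /mapP[m /sM[_ dm] ->] /mapP[n /sM[_ dn] ->]; apply: sdM.
  - by move=> _ /mapP[n ns ->]; apply: le_N.
have N0 : 0 < 2 ^+ N :> R by rewrite exprn_gt0.
rewrite -(ler_pM2r N0) mul1r mulr_suml -natrX.
apply: le_trans (_ : (\sum_(n <- s) 2 ^ (N - size (bin n)))%:R <= _); last by rewrite ler_nat.
rewrite natr_sum big_seq [leRHS]big_seq; apply: ler_sum => n ns.
have [n0 _] := sM n ns.
rewrite mulrC ler_pdivrMr ?ltr0n // -natrM ler_nat -{1}(subnK (le_N n ns)) expnD leq_mul //.
by rewrite size_bin trunc_logP.
Qed.

End Zeta.

Lemma sub_uniq_ler_sum (R : realType) (s s' : seq nat) (F : nat -> R) :
  uniq s -> uniq s' -> {subset s <= s'} -> (forall n, 0 <= F n) ->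
  \sum_(n <- s) F n <= \sum_(n <- s') F n.
Proof.
move=> us us' sub F0.
have ps : perm_eq s [seq n <- s' | n \in s].
  apply: uniq_perm; rewrite ?filter_uniq // => n; rewrite mem_filter.
  by case ns: (n \in s) => //=; rewrite sub.
rewrite (perm_big _ ps) big_filter big_mkcond; apply: ler_sum => n _.
by case: ifP => _.
Qed.

(** * The lower bound on program length *)

Section Bound.
Variables (R : realType) (U W : machine) (k : nat).

Definition halted t := [seq n <- iota 1 t | halts_by W (bin n) t].

Lemma mem_halted n t : (n \in halted t) = [&& halts_by W (bin n) t, (0 < n)%N & (n <= t)%N].
Proof. by rewrite mem_filter mem_iota add1n ltnS. Qed.

Lemma halted_sumE t :
  (halted_sum W t)%:R = t`!%:R * \sum_(n <- halted t) n%:R^-1 :> R.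
Proof.
rewrite big_filter -[t in iota 1 t]subn0 -subSS -/(index_iota 1 t.+1) big_add1 /=.
rewrite natr_sum mulr_sumr [RHS]big_mkcond /=; apply: eq_big_nat => i /andP[_ lt_i].
case: halts_by; rewrite ?mul0n // mul1n natf_div // dvdn_fact //.
Qed.

Lemma exceedsP z t : exceeds W k z t =
  (k%:R + (binary_value z)%:R / 2 ^+ size z < \sum_(n <- halted t) n%:R^-1 :> R).
Proof.
rewrite /exceeds -(ltr_nat R) !natrM natrD natrM !natrX halted_sumE.
have z0 : 0 < 2 ^+ size z :> R by rewrite exprn_gt0.
have t0 : 0 < t`!%:R :> R by rewrite ltr0n fact_gt0.
rewrite mulrCA [_ * t`!%:R]mulrC ltr_pM2l // -ltr_pdivrMl //.
by congr (_ < _); rewrite mulrDr mulrCA mulVf ?mulr1 ?gt_eqF // mulrC.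
Qed.

Lemma exists_halting_stage (s : seq nat) :
  (forall n, n \in s -> (0 < n)%N /\ dom W (bin n)) ->
  exists t0, forall t, (t0 <= t)%N -> {subset s <= halted t}.
Proof.
elim: s => [|n s IH] sW; first by exists 0%N.
have [|t0 ht0] := IH; first by move=> m ms; apply: sW; rewrite inE ms orbT.
have [n0 [y /evals_halts_by[t1 ht1 _]]] := sW n (mem_head _ _).
exists (maxn n (maxn t0 t1)) => t; rewrite !geq_max => /and3P[le_n le_t0 le_t1] m.
rewrite inE => /predU1P[->|]; last exact: ht0.
by rewrite mem_halted n0 le_n (halts_by_mono le_t1).
Qed.

Hypothesis sdU : self_delimiting U.
Hypothesis univW : forall D, self_delimiting D -> exists c : nat, forall x y,
  evals D x y -> exists p, (size p <= size x + c)%N /\ evals W p y.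
Variables (a : R) (b : nat -> bool).
Hypothesis zetaW : zeta R W = a%:E.
(** The strict inequality on the left is that of an unending expansion; it allows an integer [a]
    with [k] equal to a - 1 and all digits 1. *)
Hypothesis ab : forall m,
  k%:R + (binary_value (mkseq b m))%:R / 2 ^+ m < a <=
  k%:R + (binary_value (mkseq b m)).+1%:R / 2 ^+ m.

Lemma prefix_complexity_bound : exists c : nat, forall w m,
  evals U w (mkseq b m) -> (m <= size w + c)%N.
Proof.
have [D specD] := diagonal_machine U W k.
have sdD : self_delimiting D by move=> x y /(specD x).2 dx /(specD y).2; apply: sdU dx.
have [c univ] := univW sdD; exists c => w m Uw.
have /andP[lo hi] := ab m; rewrite -[(binary_value _).+1%:R]natr1 in hi; set v := (binary_value _)%:R in lo hi.
have lo' : ((k%:R + v / 2 ^+ m)%:E < zeta R W)%E by rewrite zetaW lte_fin.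
have [s [us sW ltq]] := zeta_gt lo'.
have [t0 ht0] := exists_halting_stage sW.
have uh t : uniq (halted t) by rewrite filter_uniq ?iota_uniq.
have [t ext Dw] : exists2 t, exceeds W k (mkseq b m) t & evals D w (nseq (diagonal_length W t) true).
  apply: (specD w).1 => //; exists t0 => t /ht0 sub.
  rewrite exceedsP size_mkseq; apply: lt_le_trans ltq _.
  by apply: sub_uniq_ler_sum => // n; rewrite invr_ge0.
have [p [le_p Wp]] := univ _ _ Dw; apply: leq_trans le_p; rewrite leqNgt; apply/negP => lt_pm.
(* A program shorter than [m] has a number n < 2^m, so it weighs more than 2^-m. If it was found by
   stage [t], its output is too short; otherwise adding 1/n to the partial sum exceeds [a]. *)
set n := unbin p; have n0 : (0 < n)%N := unbin_gt0 p.
have bn : bin n = p := unbinK p.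
have lt_n : (n < 2 ^ m)%N by apply: leq_trans (unbin_lt p) _; rewrite leq_exp2l.
have [nh|nh] := boolP (n \in halted t).
  have := nh; rewrite mem_halted bn => /and3P[hp _ le_n].
  have := evals_inj Wp (evals_at hp) => /(congr1 size); rewrite size_nseq => E.
  have : (size (output (config_at W p t)) < diagonal_length W t)%N.
    rewrite /diagonal_length (bigD1_seq n.-1) ?iota_uniq ?mem_index_iota ?prednK //=.
    by rewrite bn hp mul1n ltn_addr.
  by rewrite E ltnn.
have : ((\sum_(i <- n :: halted t) i%:R^-1 : R)%:E <= zeta R W)%E.
  apply: zeta_ge => [|i]; first by rewrite /= nh uh.
  rewrite inE => /predU1P[->|]; first by split=> //; rewrite bn; exists (nseq (diagonal_length W t) true).
  by rewrite mem_halted => /and3P[/evals_at h ? _]; split=> //; eexists; exact: h.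
rewrite zetaW lee_fin big_cons leNgt => /negP; apply.
move: ext; rewrite exceedsP size_mkseq -/v => ext.
apply: le_lt_trans hi _; rewrite mulrDl mul1r addrA addrC ltrD //.
rewrite ltf_pV2 ?posrE ?exprn_gt0 ?ltr0n //.
by rewrite -natrX ltr_nat.
Qed.

End Bound.

(** * Unending expansions and conclusion *)

Lemma unending_expansion_exists (R : realType) (x : R) : 0 < x <= 1 ->
  exists b : nat -> bool, unending_expansion b x /\
    forall m, (binary_value (mkseq b m))%:R / 2 ^+ m < x <=
              (binary_value (mkseq b m)).+1%:R / 2 ^+ m.
Proof.
move=> x01.
(* The remainders under doubling. The digit is 1 only for a remainder strictly above 1/2, which
   keeps all remainders in ]0, 1] and makes the expansion unending. *)
pose r n := iter n (fun y : R => 2 * y - (2^-1 < y)%R%:R) x.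
have rS n : r n.+1 = 2 * r n - (2^-1 < r n)%R%:R by [].
have r01 n : 0 < r n <= 1.
  elim: n => [//|n /andP[r0 r1]]; rewrite rS.
  by case: (ltP 2^-1 (r n)) => h; rewrite ?mulr0n ?mulr1n; apply/andP; split; lra.
pose b n := 2^-1 < r n.
have p0 m : 0 < 2 ^+ m :> R by rewrite exprn_gt0.
have bE m : x = (binary_value (mkseq b m))%:R / 2 ^+ m + r m / 2 ^+ m.
  elim: m => [|m IH].
    by rewrite /binary_value big_nil mul0r add0r expr0 divr1.
  rewrite mkseqS binary_value_rcons natrD natrM {1}IH exprS rS -/(b m).
  by field; rewrite gt_eqF.
have sE m : series (fun i => (b i)%:R / 2 ^+ i.+1 : R) m = (binary_value (mkseq b m))%:R / 2 ^+ m.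
  elim: m => [|m IH].
    by rewrite /series /= big_nil /binary_value big_nil mul0r.
  rewrite seriesSr IH mkseqS binary_value_rcons natrD natrM !exprS.
  by field; rewrite gt_eqF.
exists b; split; last first.
  move=> m; have /andP[r0 r1] := r01 m.
  rewrite {1}(bE m) ltrDl divr_gt0 //= {1}(bE m) -[(binary_value _).+1%:R]natr1 mulrDl lerD2l ler_pM2r ?invr_gt0 //.
split.
  have -> : series (fun i => (b i)%:R / 2 ^+ i.+1 : R) = (fun m => x - r m / 2 ^+ m).
    by apply/funext => m; rewrite sE {1}(bE m) addrK.
  rewrite -[X in _ --> X]subr0; apply: cvgB; first exact: cvg_cst.
  apply: (@squeeze_cvgr _ _ _ _ (fun=> 0) (fun m => (2^-1) ^+ m)).
  - near=> m; have /andP[r0 r1] := r01 m.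
    apply/andP; split; first by rewrite divr_ge0 ?ltW.
    by rewrite exprVn ler_pdivrMr // mulVf ?gt_eqF.
  - exact: cvg_cst.
  - by apply: cvg_expr; rewrite ger0_norm; lra.
move=> n; apply: contrapT => nb.
(* Without further digits 1 the remainder would double forever and exceed 1. *)
have r2 i : r (n + i)%N = 2 ^+ i * r n.
  elim: i => [|i IH]; first by rewrite addn0 expr0 mul1r.
  rewrite addnS rS -/(b (n + i)%N) (_ : b (n + i)%N = false) ?IH ?exprS; first by rewrite subr0 mulrA.
  by apply/negP => h; apply: nb; exists (n + i)%N; rewrite leq_addr.
have /andP[r0 _] := r01 n.
pose i := (Num.truncn (r n)^-1).+1.
have /andP[_ r1] := r01 (n + i)%N.
move: r1; rewrite r2; apply/negP; rewrite -ltNge.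
rewrite -ltr_pdivrMr // div1r; apply: lt_le_trans (truncnS_gt _) _.
by rewrite -natrX ler_nat ltnW // ltn_expl.
Unshelve. all: by end_near.
Qed.

Theorem theorem30 (R : realType) (U0 : machine)
    (hU0 : self_delimiting U0)
    (hU0_univ : universal_for self_delimiting U0)
    (W : machine)
    (hW : (convergent R W /\ universal_for (convergent R) W) \/
          (tuatara R W /\ universal_for (tuatara R) W)) :
  random U0 (fine (zeta R W)).
Proof.
have zfin : zeta R W \is a fin_num.
  rewrite ge0_fin_numE ?zeta_ge0 //; case: hW => -[] // le1 _.
  exact: le_lt_trans le1 (ltry _).
have univW D : self_delimiting D -> exists c : nat, forall x y,
    evals D x y -> exists p, (size p <= size x + c)%N /\ evals W p y.
  move=> /(@self_delimiting_tuatara R) tD; case: hW => -[_ univ]; apply: univ => //.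
  exact: le_lt_trans tD (ltry _).
set a := fine (zeta R W).
have zetaW : zeta R W = a%:E by rewrite fineK.
have [E [sdE evE]] := unary_machine.
(* Universality gives at least one halting program of [W], whose term is positive. *)
have a0 : 0 < a.
  have [c univ] := univW _ sdE; have [p [_ Wp]] := univ _ _ (evE 0%N).
  apply: lt_le_trans (_ : (unbin p)%:R^-1 <= a); first by rewrite invr_gt0 ltr0n unbin_gt0.
  have := @zeta_ge R W [:: unbin p] isT; rewrite zetaW lee_fin big_seq1.
  by apply=> n; rewrite inE => /eqP ->; rewrite unbinK unbin_gt0; split=> //; exists (nseq 0 true).
have [k fk] : exists k : nat, Num.floor a = k%:Z.
  by exists `|Num.floor a|%N; rewrite gez0_abs // floor_ge0 ltW.
have fkR : (Num.floor a)%:~R = k%:R :> R by rewrite fk -pmulrn.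
have /andP[] := floor_itv a; rewrite intrD fkR => le_ka lt_ak.
(* If [a] were the integer [k], the bound would apply to k - 1 and the digits 0.111..., whose
   prefixes are cheap on the machine [E]. *)
have lt_ka : k%:R < a.
  rewrite lt_neqAle le_ka andbT; apply/eqP => ka.
  have k0 : (0 < k)%N by rewrite -(ltr_nat R) ka.
  have ones m : mkseq (fun=> true) m = nseq m true.
    by apply: (@eq_from_nth _ false) => [|i]; rewrite size_mkseq ?size_nseq // => lt_i; rewrite nth_mkseq // nth_nseq lt_i.
  have val m : (binary_value (mkseq (fun=> true) m)).+1 = (2 ^ m)%N.
    elim: m => [|m IH]; first by rewrite /binary_value big_nil.
    by rewrite mkseqS binary_value_rcons expnS -IH; lia.
  have [|c bound] := @prefix_complexity_bound R _ _ k.-1 sdE univW a (fun=> true) zetaW.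
    move=> m; have pm : 0 < 2 ^+ m :> R by rewrite exprn_gt0.
    have vE : (binary_value (mkseq (fun=> true) m)).+1%:R = 2 ^+ m :> R by rewrite val natrX.
    have kE : k.-1%:R + 1 = k%:R :> R by rewrite natr1 prednK.
    rewrite vE divff ?gt_eqF // -ka -kE lexx andbT ltrD2l.
    by rewrite ltr_pdivrMr // mul1r -vE ltr_nat.
  (* The program has c + 3 bits and the output 2c + 4, one more than the bound 2c + 3 allows. *)
  have := bound (unary c.+2) (2 * c.+2)%N; rewrite ones size_rcons size_nseq => /(_ (evE _)).
  lia.
have [|b [bx bP]] := @unending_expansion_exists R (a - k%:R); first by apply/andP; split; lra.
exists b; split; first by rewrite fkR.
have [|c bound] := @prefix_complexity_bound R _ _ k hU0 univW a b zetaW.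
  by move=> m; have /andP[lo hi] := bP m; apply/andP; split; lra.
exists c => m _; apply: le_ereal_inf_tmp => _ [w Uw <-].
by rewrite lee_fin lerBlDr -natrD ler_nat; apply: bound.
Qed.
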